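(* Let $n\ge2$ and let $Q$ be a convex $(n+3)$-gon in $\mathbb R^2$. The associahedron $\mathrm{GKZ}_n(Q)$, obtained as the secondary polytope of $Q$, is not normally isomorphic to any Hohlweg--Lange associahedron $\mathrm{Ass}^{\mathrm I}_n(\sigma)$ with $\sigma\in\{+,-\}^{n-1}$, nor to any Santos associahedron $\mathrm{Ass}^{\mathrm{II}}_n(T)$ with $T$ a triangulation of a convex $(n+3)$-gon.
   Context: **Normal isomorphism.** Two complete fans in real vector spaces $V,V'$ of the same dimension are linearly isomorphic if there is a linear isomorphism $V\to V'$ sending each cone of one fan to a cone of the other. Two polytopes are normally isomorphic if their normal fans are linearly isomorphic. (For a polytope that is not full-dimensional in its ambient space, the normal fan is taken modulo its lineality space.) **Polygons.** A diagonal of a convex polygon means an internal diagonal; two diagonals cross if they meet in a point interior to both. A triangulation of a convex $(n+3)$-gon (without new vertices) is identified with its set of $n$ pairwise non-crossing diagonals. **Secondary polytope.** For a convex polygon $Q$ with vertices $q_1,\dots,q_{n+3}$ and a triangulation $t$ of $Q$, let $v(t)=\sum_{i}\sum_{\sigma\in t:\,q_i\in\sigma}\operatorname{vol}(\sigma)e_i\in\mathbb R^{n+3}$ (sum over triangles $\sigma$ of $t$ with vertex $q_i$). Then $\mathrm{GKZ}_n(Q)=\operatorname{conv}\{v(t):t\text{ a triangulation of }Q\}$, an $n$-dimensional polytope. **Hohlweg--Lange associahedra.** For $\sigma\in\{+,-\}^{n-1}$ let $\widetilde\sigma=(+,-,\sigma,-,+)$, indexed by $0,1,\dots,n+2$.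 Let $P_{n+3}(\sigma)$ be a convex $(n+3)$-gon with vertices labelled $0,1,\dots,n+2$ from left to right, with the vertices of sign $+$ above a fixed horizontal line and those of sign $-$ below it. For a diagonal $ij$ ($i<j$), let $R_{ij}(\sigma)$ be the set of vertices strictly below it, and let $S_{ij}(\sigma)$ be obtained from $R_{ij}(\sigma)$ by replacing $0$ by $i$ if $0\in R_{ij}(\sigma)$ and $n+2$ by $j$ if $n+2\in R_{ij}(\sigma)$. Then $\mathrm{Ass}^{\mathrm I}_n(\sigma)$ is the set of $x\in\mathbb R^{n+1}$ with $\sum_i x_i=\frac{(n+1)(n+2)}2$ and $\sum_{i\in S_\delta(\sigma)}x_i\ge\frac12|S_\delta(\sigma)|(|S_\delta(\sigma)|+1)$ for all diagonals $\delta$. **Santos associahedra.** Let $\alpha_1,\dots,\alpha_n$ be a basis of a real vector space $V$ and $T_0=\{\delta_1,\dots,\delta_n\}$ a triangulation of a convex $(n+3)$-gon. For each diagonal $pq$ let $v_{pq}=-\alpha_i$ if $pq=\delta_i$, and $v_{pq}=\sum_{i:\ pq\text{ crosses }\delta_i}\alpha_i$ if $pq\notin T_0$. The cones generated by $\{v_\delta:\delta\in T\}$, for all triangulations $T$, are the maximal cones of a complete simplicial fan $\mathcal F_{T_0}$ in $V$, which is the normal fan of a polytope; $\mathrm{Ass}^{\mathrm{II}}_n(T_0)$ denotes any polytope with normal fan $\mathcal F_{T_0}$. *)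

(* Defs.v *)
From HB Require Import structures.
From mathcomp Require Import all_boot all_order all_algebra.
From mathcomp Require Import boolp classical_sets reals.

Set Implicit Arguments.
Unset Strict Implicit.
Unset Printing Implicit Defensive.

Import Order.TTheory GRing.Theory Num.Theory.

Local Open Scope classical_set_scope.
Local Open Scope ring_scope.

(** ** Convex hulls, cones, fans and normal fans *)

Definition conv_hull (R : realType) (E : lmodType R) (A : set E) : set E :=
  [set x | exists (k : nat) (w : 'I_k -> R) (a : 'I_k -> E),
     [/\ forall i, 0 <= w i, \sum_(i < k) w i = 1, forall i, A (a i)
       & x = \sum_(i < k) w i *: a i]].

Definition is_polytope (R : realType) (E : lmodType R) (P : set E) : Prop :=
  exists s : seq E, P = conv_hull [set` s].

(* The face of [P] on which the linear form [c] is maximal. *)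
Definition max_face (R : realType) (E : vectType R) (P : set E)
    (c : 'Hom(E, R^o)) : set E :=
  [set x | P x /\ forall y, P y -> (c y : R) <= c x].

Definition is_face (R : realType) (E : vectType R) (P F : set E) : Prop :=
  F !=set0 /\ exists c : 'Hom(E, R^o), F = max_face P c.

Definition normal_cone (R : realType) (E : vectType R) (P F : set E) :
    set 'Hom(E, R^o) :=
  [set c | F `<=` max_face P c].

(* A fan is represented by the set of all its cones. *)
Definition normal_fan (R : realType) (E : vectType R) (P : set E) :
    set (set 'Hom(E, R^o)) :=
  [set normal_cone P F | F in is_face P].

Definition lineality (R : realType) (V : vectType R) (F : set (set V)) :
    set V :=
  [set v | forall C, F C -> C v /\ C (- v)].

(* [F] is the normal fan of [P] modulo its lineality space [L]: the quotient
   of the dual space by [L] is presented as a surjective linear map [p] onto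
   [V] with kernel [L]. *)
Definition has_normal_fan (R : realType) (E V : vectType R) (P : set E)
    (F : set (set V)) : Prop :=
  exists p : 'Hom('Hom(E, R^o), V),
    [/\ forall v, exists c, p c = v,
        forall c, p c = 0 <-> lineality (normal_fan P) c
      & F = [set p @` C | C in normal_fan P]].

Definition linearly_isomorphic (R : realType) (V V' : vectType R)
    (F : set (set V)) (F' : set (set V')) : Prop :=
  exists f : 'Hom(V, V'), bijective f /\ forall C, F C -> F' (f @` C).

Definition normally_isomorphic (R : realType) (E E' : vectType R)
    (P : set E) (P' : set E') : Prop :=
  exists (V V' : vectType R) (F : set (set V)) (F' : set (set V')),
    [/\ has_normal_fan P F, has_normal_fan P' F' & linearly_isomorphic F F'].

(** ** Polygons and triangulations *)

Definition abscissa (R : realType) (a : 'rV[R]_2) : R := a 0 0.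
Definition ordinate (R : realType) (a : 'rV[R]_2) : R := a 0 1.

(* Twice the signed area of the triangle [abc]; positive iff [c] lies to the
   left of the line directed from [a] to [b]. *)
Definition orient (R : realType) (a b c : 'rV[R]_2) : R :=
  (abscissa b - abscissa a) * (ordinate c - ordinate a)
  - (ordinate b - ordinate a) * (abscissa c - abscissa a).

Definition area (R : realType) (a b c : 'rV[R]_2) : R := `|orient a b c| / 2.

(* The points [q i] are the vertices of a convex polygon: none of them is in
   the convex hull of the others.  The labelling need not follow the boundary
   of the polygon. *)
Definition convex_polygon (R : realType) (m : nat) (q : 'I_m -> 'rV[R]_2) :
    Prop :=
  forall i, ~ conv_hull [set q j | j in [set j | j != i]] (q i).

(* The line through [q i] and [q j] supports the polygon. *)
Definition adjacent (R : realType) (m : nat) (q : 'I_m -> 'rV[R]_2)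
    (i j : 'I_m) : bool :=
  (i != j) && ([forall k, 0 <= orient (q i) (q j) (q k)]
            || [forall k, orient (q i) (q j) (q k) <= 0]).

(* A diagonal is the pair of its end points, in increasing order of labels. *)
Definition diagonal (R : realType) (m : nat) (q : 'I_m -> 'rV[R]_2)
    (d : 'I_m * 'I_m) : bool :=
  (d.1 < d.2)%N && ~~ adjacent q d.1 d.2.

Definition cross (R : realType) (m : nat) (q : 'I_m -> 'rV[R]_2)
    (d e : 'I_m * 'I_m) : Prop :=
  d <> e /\ exists s t : R,
    [/\ 0 < s < 1, 0 < t < 1 &
        (1 - s) *: q d.1 + s *: q d.2 = (1 - t) *: q e.1 + t *: q e.2].

Definition triangulation (R : realType) (n : nat) (q : 'I_n.+3 -> 'rV[R]_2)
    (T : {set 'I_n.+3 * 'I_n.+3}) : Prop :=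
  [/\ #|T| = n, forall d, d \in T -> diagonal q d
    & forall d e, d \in T -> e \in T -> ~ cross q d e].

(** ** Secondary polytopes *)

(* Triangles are given by their vertices in increasing order of labels. *)
Definition triangle_of (R : realType) (m : nat) (q : 'I_m -> 'rV[R]_2)
    (T : {set 'I_m * 'I_m}) (s : 'I_m * 'I_m * 'I_m) : bool :=
  let side (i j : 'I_m) := (i < j)%N && (adjacent q i j || ((i, j) \in T)) in
  let: (i, j, k) := s in [&& side i j, side j k & side i k].

Definition gkz_vector (R : realType) (m : nat) (q : 'I_m -> 'rV[R]_2)
    (T : {set 'I_m * 'I_m}) : 'rV[R]_m :=
  \row_l \sum_(s : 'I_m * 'I_m * 'I_m |
                 triangle_of q T s && (l \in [:: s.1.1; s.1.2; s.2]))
           area (q s.1.1) (q s.1.2) (q s.2).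

Definition GKZ (R : realType) (n : nat) (q : 'I_n.+3 -> 'rV[R]_2) :
    set 'rV[R]_n.+3 :=
  conv_hull [set gkz_vector q T | T in triangulation q].

(** ** Hohlweg-Lange associahedra *)

(* Signs are booleans, [true] being [+]. *)
Definition extended_signs (s : seq bool) : seq bool :=
  [:: true, false & s] ++ [:: false; true].

(* [p] can serve as the polygon P_{n+3}(sigma). *)
Definition signed_polygon (R : realType) (n : nat) (sigma : n.-1.-tuple bool)
    (p : 'I_n.+3 -> 'rV[R]_2) : Prop :=
  [/\ convex_polygon p,
      forall i j : 'I_n.+3, (i < j)%N -> abscissa (p i) < abscissa (p j)
    & exists h : R, forall i : 'I_n.+3,
        if nth true (extended_signs sigma) i then h < ordinate (p i)
        else ordinate (p i) < h].

(* As end points are labelled from left to right, below the line through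
   [p d.1] and [p d.2] means to the right of it when directed from [p d.1] to
   [p d.2]. *)
Definition below_set (R : realType) (m : nat) (p : 'I_m -> 'rV[R]_2)
    (d : 'I_m * 'I_m) : {set 'I_m} :=
  [set k | orient (p d.1) (p d.2) (p k) < 0]%SET.

Definition replace_in (T : finType) (a b : T) (A : {set T}) : {set T} :=
  if a \in A then b |: (A :\ a) else A.

Definition HL_set (R : realType) (n : nat) (p : 'I_n.+3 -> 'rV[R]_2)
    (d : 'I_n.+3 * 'I_n.+3) : {set 'I_n.+3} :=
  replace_in ord_max d.2 (replace_in ord0 d.1 (below_set p d)).

(* [HL_set p d] is contained in {1, ..., n+1}, and the coordinate x_k
   (1 <= k <= n+1) is [x 0 i] with [i = k - 1]. *)
Definition AssI (R : realType) (n : nat) (p : 'I_n.+3 -> 'rV[R]_2) :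
    set 'rV[R]_n.+1 :=
  [set x | \sum_(i < n.+1) x 0 i = (n.+1 * n.+2)%N%:R / 2
    /\ forall d, diagonal p d ->
         \sum_(i < n.+1 | inord i.+1 \in HL_set p d) x 0 i
           >= (#|HL_set p d| * #|HL_set p d|.+1)%N%:R / 2].

(** ** Santos associahedra *)

Definition cone_generated (R : realType) (V : lmodType R) (I : finType)
    (S : {set I}) (v : I -> V) : set V :=
  [set x | exists w : I -> R,
     (forall i, 0 <= w i) /\ x = \sum_(i in S) w i *: v i].

(* The initial triangulation is [delta_1, ..., delta_n]. *)
Definition santos_vector (R : realType) (n : nat) (q : 'I_n.+3 -> 'rV[R]_2)
    (V : vectType R) (alpha : n.-tuple V)
    (delta : n.-tuple ('I_n.+3 * 'I_n.+3)) (d : 'I_n.+3 * 'I_n.+3) : V :=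
  if [pick i | tnth delta i == d] is Some i then - tnth alpha i
  else \sum_(i < n | `[< cross q d (tnth delta i) >]) tnth alpha i.

(* The cones generated by subsets of triangulations are the faces of the
   maximal cones, since the fan is simplicial. *)
Definition santos_fan (R : realType) (n : nat) (q : 'I_n.+3 -> 'rV[R]_2)
    (V : vectType R) (alpha : n.-tuple V)
    (delta : n.-tuple ('I_n.+3 * 'I_n.+3)) : set (set V) :=
  [set C | exists T S : {set 'I_n.+3 * 'I_n.+3},
     [/\ triangulation q T, S \subset T
       & C = cone_generated S (santos_vector q alpha delta)]].

Definition is_AssII (R : realType) (n : nat) (q : 'I_n.+3 -> 'rV[R]_2)
    (T0 : {set 'I_n.+3 * 'I_n.+3}) (E : vectType R) (P : set E) : Prop :=
  is_polytope P /\
  exists (V : vectType R) (alpha : n.-tuple V)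
      (delta : n.-tuple ('I_n.+3 * 'I_n.+3)),
    [/\ basis_of fullv alpha, T0 = [set d in delta]%SET
      & has_normal_fan P (santos_fan q alpha delta)].

(* Main.v *)
Require Import Defs.
From HB Require Import structures.
From mathcomp Require Import all_boot all_order all_algebra.
From mathcomp Require Import boolp classical_sets reals.
From mathcomp Require Import perm zify ring lra.

Set Implicit Arguments.
Unset Strict Implicit.
Unset Printing Implicit Defensive.

Import Order.TTheory GRing.Theory Num.Theory.

Local Open Scope classical_set_scope.
Local Open Scope ring_scope.

(** The secondary polytope has no two parallel facets, whereas both families of
    associahedra have some. In terms of normal fans: no two opposite rays.

    Heights [c] on the vertices of [Q] are linear forms on the secondary
    polytope, and those which are affine on [Q] are constant on it. For a
    diagonal [d] with supporting line [l = 0], the fold [|l|] is minimal exactly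
    at the triangulations that contain [d]. Flipping the diagonals of a
    triangulation [T] one at a time shows that the folds of its diagonals
    together with the affine heights form a basis of all heights, and that [T]
    is maximal for [c] only if [c] is affine plus a nonpositive combination of
    these folds; hence every ray of the normal fan is spanned by some [-|l|].
    Two opposite rays would make some [s |l| + t |l'|] affine on the vertices of
    [Q], which is impossible for at least five vertices: three of them lie in a
    common closed region cut out by the two lines, so that the combination is
    the one given by the signs of this region on all of [Q].

    In Santos' fan, the flip of [delta_1] gives the ray opposite to
    [- alpha_1]. In a Hohlweg-Lange associahedron, the ears at the vertices 1
    and 0 give the facets [x_1 = 1] and [x_1 = n + 1]. *)

(** A linear isomorphism is only assumed to send cones of the first fan to cones of the second;
    nothing is said about its inverse. Opposite rays are therefore pulled back to the secondary
    polytope. The image of a normal cone is a priori the normal cone of an unknown face, and a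
    relative interior argument forces it into the given ray. The labels of the vertices need not
    follow the boundary. A counterclockwise enumeration, started at a vertex of choice, turns
    orientations into inequalities between positions and triangulations into noncrossing families of
    pairs of naturals. Values on different triangulations are compared without integrating: relative
    to a base vertex, the contribution of a triangle is a sum of edge terms, which telescope, plus a
    local [excess]. When the base vertex is an end of the diagonal, the excess of its fold is
    nonnegative triangle by triangle. The argument needs five vertices: on a square, the folds along
    the two diagonals add up to a constant, and the secondary polytope is a segment, with two
    opposite rays. *)

Section PlaneGeometry.

Variable R : realType.

Implicit Types a b c d : 'rV[R]_2.

Lemma point_eq a b : abscissa a = abscissa b -> ordinate a = ordinate b -> a = b.
Proof.
move=> h0 h1; apply/rowP => -[[|[|//]] hi].
  by rewrite (_ : Ordinal hi = 0) //; apply: val_inj.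
by rewrite (_ : Ordinal hi = 1) //; apply: val_inj.
Qed.

Lemma abscissaD a b : abscissa (a + b) = abscissa a + abscissa b.
Proof. by rewrite /abscissa mxE. Qed.

Lemma ordinateD a b : ordinate (a + b) = ordinate a + ordinate b.
Proof. by rewrite /ordinate mxE. Qed.

Lemma abscissaZ (s : R) a : abscissa (s *: a) = s * abscissa a.
Proof. by rewrite /abscissa mxE. Qed.

Lemma ordinateZ (s : R) a : ordinate (s *: a) = s * ordinate a.
Proof. by rewrite /ordinate mxE. Qed.

Definition coordE := (abscissaD, ordinateD, abscissaZ, ordinateZ).

Lemma orient_cycle a b c : orient b c a = orient a b c.
Proof. by rewrite /orient; ring. Qed.

Lemma orient_swap a b c : orient b a c = - orient a b c.
Proof. by rewrite /orient; ring. Qed.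

Lemma orient_swap_last a b c : orient a c b = - orient a b c.
Proof. by rewrite /orient; ring. Qed.

Lemma orient_same a b : orient a b a = 0 /\ orient a b b = 0.
Proof. by rewrite /orient; split; ring. Qed.

Lemma orient_diag a b : orient a a b = 0.
Proof. by rewrite /orient; ring. Qed.

Lemma orient_decomp a b c d :
  orient a b c = orient a b d + orient b c d + orient c a d.
Proof. by rewrite /orient; ring. Qed.

Lemma orient_affine (s : R) a b c d :
  orient a b ((1 - s) *: c + s *: d) = (1 - s) * orient a b c + s * orient a b d.
Proof. by rewrite /orient !coordE; ring. Qed.

(** * Points in convex position and their counterclockwise enumeration *)

Section ConvexPosition.

Variables (m : nat) (q : 'I_m -> 'rV[R]_2).
Hypothesis hq : convex_polygon q.

Lemma vertex_not_in_segment l i j (s : R) : l != i -> l != j -> 0 <= s <= 1 ->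
  q l <> (1 - s) *: q i + s *: q j.
Proof.
move=> li lj /andP[s0 s1] qE; apply: (hq (i := l)).
exists 2, (fun k : 'I_2 => nth 0 [:: 1 - s; s] k),
  (fun k : 'I_2 => nth 0 [:: q i; q j] k); split.
- by case=> [[|[|//]] ?] /=; rewrite ?subr_ge0.
- by rewrite !big_ord_recl big_ord0 /= addr0 subrK.
- by case=> [[|[|//]] ?] /=; [exists i | exists j] => //=; rewrite eq_sym.
- by rewrite qE !big_ord_recl big_ord0 /= addr0.
Qed.

(** The three inner orientations divided by the orientation of the whole triangle are the
    barycentric coordinates of [q l]; they add up to 1 by [orient_decomp]. *)
Lemma vertex_not_in_triangle l i j k : l != i -> l != j -> l != k ->
  0 <= orient (q i) (q j) (q l) -> 0 <= orient (q j) (q k) (q l) ->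
  0 <= orient (q k) (q i) (q l) -> 0 < orient (q i) (q j) (q k) -> False.
Proof.
move=> li lj lk h1 h2 h3 h; apply: (hq (i := l)).
have dec := orient_decomp (q i) (q j) (q k) (q l).
set D := orient (q i) (q j) (q k) in h dec.
have D0 : D != 0 by rewrite gt_eqF.
exists 3, (fun t : 'I_3 => nth 0 [:: orient (q j) (q k) (q l) / D;
     orient (q k) (q i) (q l) / D; orient (q i) (q j) (q l) / D] t),
  (fun t : 'I_3 => nth 0 [:: q i; q j; q k] t); split.
- by case=> [[|[|[|//]]] ?] /=; rewrite divr_ge0 // ltW.
- by rewrite !big_ord_recl big_ord0 /= addr0 -!mulrDl addrA (addrC (_ + _))
    addrA -dec divff.
- by case=> [[|[|[|//]]] ?] /=; [exists i | exists j | exists k] => //=; rewrite eq_sym.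
- rewrite !big_ord_recl big_ord0 /= addr0.
  apply: point_eq; rewrite !coordE; apply: (mulfI D0); rewrite /D /orient in D0 *;
    by field.
Qed.

Lemma vertex_inj : injective q.
Proof.
move=> i j E; apply/eqP/negPn/negP => ne; apply: (@vertex_not_in_segment i j j 0) => //.
  by rewrite lexx ler01.
by rewrite subr0 scale1r scale0r addr0.
Qed.

Lemma vertices_not_collinear i j k : i != j -> j != k -> i != k ->
  orient (q i) (q j) (q k) != 0.
Proof.
move=> ij jk ik; apply/eqP => col.
set ux := abscissa (q j) - abscissa (q i); set uy := ordinate (q j) - ordinate (q i).
set vx := abscissa (q k) - abscissa (q i); set vy := ordinate (q k) - ordinate (q i).
have N0 : ux ^+ 2 + uy ^+ 2 != 0.
  rewrite paddr_eq0 ?sqr_ge0 // !sqrf_eq0 !subr_eq0; apply/negP => /andP[/eqP e1 /eqP e2].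
  by move/eqP: ij; apply; apply: vertex_inj; apply: point_eq.
have Npos : 0 < ux ^+ 2 + uy ^+ 2 by rewrite lt_neqAle eq_sym N0 addr_ge0 ?sqr_ge0.
(* The scalar projection of [q k] on the line through [q i] and [q j]; this formula needs no case
   split on which coordinate of the direction is nonzero. The position of [t] with respect to 0 and
   1 then tells which of the three points lies between the other two. *)
pose t := (ux * vx + uy * vy) / (ux ^+ 2 + uy ^+ 2).
have col' : ux * vy = uy * vx by apply/eqP; rewrite -subr_eq0; apply/eqP.
have tx : vx = t * ux.
  apply: (mulfI N0); rewrite /t mulrA mulrCA divff // mulr1.
  have -> : (ux * vx + uy * vy) * ux = ux ^+ 2 * vx + uy * (ux * vy) by ring.
  by rewrite col'; ring.
have ty : vy = t * uy.
  apply: (mulfI N0); rewrite /t mulrA mulrCA divff // mulr1.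
  have -> : (ux * vx + uy * vy) * uy = ux * (uy * vx) + uy ^+ 2 * vy by ring.
  by rewrite -col'; ring.
have qk : q k = (1 - t) *: q i + t *: q j.
  apply: point_eq; rewrite !coordE.
    have -> : abscissa (q k) = vx + abscissa (q i) by rewrite /vx subrK.
    by rewrite tx /ux; ring.
  have -> : ordinate (q k) = vy + ordinate (q i) by rewrite /vy subrK.
  by rewrite ty /uy; ring.
have [t0|t0] := lerP 0 t; last first.
  have u0 : 1 - t != 0 by rewrite subr_eq0 gt_eqF // (lt_trans t0).
  apply: (@vertex_not_in_segment i k j (- t / (1 - t))) => //.
    have u1 : 0 < 1 - t by lra.
    by rewrite divr_ge0 ?oppr_ge0 ?(ltW t0) ?(ltW u1) //= ler_pdivrMr //; lra.
  by apply: point_eq; rewrite qk !coordE; field.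
have [t1|t1] := lerP t 1.
  by apply: (@vertex_not_in_segment k i j t) => //; rewrite 1?eq_sym // t0.
have t'0 : t != 0 by rewrite gt_eqF // (lt_trans _ t1).
apply: (@vertex_not_in_segment j i k t^-1) => //; rewrite 1?eq_sym //.
  by rewrite invr_ge0 t0 invf_le1 ?(ltW t1) // (lt_trans _ t1).
by apply: point_eq; rewrite qk !coordE; field.
Qed.

Lemma orient_gt0_lt0 i j k : i != j -> j != k -> i != k ->
  (0 < orient (q i) (q j) (q k)) = ~~ (orient (q i) (q j) (q k) < 0).
Proof.
by move=> ij jk ik; rewrite -leNgt le_eqVlt eq_sym (negPf (vertices_not_collinear _ _ _)).
Qed.

Definition ccw_sorted (s : {perm 'I_m}) :=
  forall a b c : 'I_m, (a < b)%N -> (b < c)%N -> 0 < orient (q (s a)) (q (s b)) (q (s c)).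

(** The vertices other than [o] are sorted by their angle seen from [o]. The freedom in choosing [o]
    later puts an end of a given diagonal at position 0. *)
Lemma exists_ccw_sorted (o : 'I_m) : exists s : {perm 'I_m},
  ccw_sorted s /\ forall z : 'I_m, val z = 0%N -> s z = o.
Proof.
pose r i j := 0 <= orient (q o) (q i) (q j).
have r_lt i j : i != o -> j != o -> i != j -> r i j -> 0 < orient (q o) (q i) (q j).
  move=> io jo ij; rewrite /r le_eqVlt eq_sym (negPf (vertices_not_collinear _ _ _)) //.
    by rewrite eq_sym.
  by rewrite eq_sym.
pose P := [pred i : 'I_m | i != o].
have r_total : {in P &, total r}.
  move=> i j _ _; rewrite /r [X in _ || (_ <= X)]orient_swap_last oppr_ge0.
  exact: le_total.
(* Angular comparison is not transitive in general: a cycle [i], [j], [k] would enclose [q o], which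
   convex position forbids. *)
have r_trans : {in P & &, transitive r}.
  move=> j i k; rewrite !inE => jo io ko rij rjk.
  case: (eqVneq i j) => [->//|ij]; case: (eqVneq j k) => [<-//|jk].
  case: (eqVneq i k) => [->|ik]; first by rewrite /r; have [_ ->] := orient_same (q o) (q k).
  rewrite /r leNgt; apply/negP => rik.
  have a1 := r_lt _ _ io jo ij rij; have a2 := r_lt _ _ jo ko jk rjk.
  have a3 : 0 < orient (q k) (q i) (q o).
    by rewrite orient_cycle orient_swap_last oppr_gt0.
  apply: (@vertex_not_in_triangle o i j k); rewrite 1?eq_sym //.
  - by rewrite orient_cycle ltW.
  - by rewrite orient_cycle ltW.
  - by rewrite ltW.
  rewrite (orient_decomp _ _ _ (q o)); apply: addr_gt0 => //.
  by apply: addr_gt0; rewrite orient_cycle.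
pose l := o :: sort r (rem o (enum 'I_m)).
have lperm : perm_eq l (enum 'I_m).
  rewrite /l (perm_trans _ (_ : perm_eq (o :: rem o (enum 'I_m)) _)) //.
    by rewrite perm_cons perm_sort.
  by rewrite perm_sym perm_to_rem // mem_enum.
have lsz : size l = m by rewrite (perm_size lperm) size_enum_ord.
have luniq : uniq l by rewrite (perm_uniq lperm) enum_uniq.
have s_inj : injective (fun a : 'I_m => nth o l a).
  by move=> a b /eqP; rewrite nth_uniq ?lsz // => /eqP /val_inj.
exists (perm s_inj); split; last by move=> z z0; rewrite permE z0.
have allP' : all P (rem o (enum 'I_m)).
  by apply/allP => x; rewrite mem_rem_uniq ?enum_uniq // !inE => /andP[].
have allP2 : all P (sort r (rem o (enum 'I_m))) by rewrite all_sort.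
have srt : pairwise r (sort r (rem o (enum 'I_m))).
  rewrite -(sorted_pairwise_in r_trans allP2); exact: (sort_sorted_in r_total).
have nthP (a : 'I_m) : (0 < a)%N -> P (nth o l a).
  move=> a0; rewrite /l -(prednK a0) /=; apply: (allP allP2); apply: mem_nth.
  by rewrite -ltnS (prednK a0) -[X in (_ < X)%N]/(size l) lsz.
have r_nth (a b : 'I_m) : (0 < a < b)%N -> 0 < orient (q o) (q (nth o l a)) (q (nth o l b)).
  move=> /andP[a0 ab]; have b0 : (0 < b)%N by apply: ltn_trans ab.
  apply: r_lt; [exact: nthP | exact: nthP | by rewrite nth_uniq ?lsz ?ltn_eqF | ].
  rewrite /l -(prednK a0) -(prednK b0) /=; apply: (pairwiseP o srt); rewrite ?inE.
  - by rewrite -ltnS (prednK a0) -[X in (_ < X)%N]/(size l) lsz.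
  - by rewrite -ltnS (prednK b0) -[X in (_ < X)%N]/(size l) lsz.
  - by rewrite -ltnS !prednK.
move=> a b c ab bc; rewrite !permE.
have ac := ltn_trans ab bc; have b0 : (0 < b)%N by apply: leq_ltn_trans ab.
have c0 : (0 < c)%N by apply: leq_ltn_trans bc.
case: (posnP a) => [a0|a0]; first by rewrite a0 /=; apply: r_nth; rewrite b0.
have ne x y : x != y -> nth o l (x : 'I_m) != nth o l (y : 'I_m).
  by rewrite nth_uniq ?lsz.
have ab' : a != b by rewrite -val_eqE ltn_eqF.
have bc' : b != c by rewrite -val_eqE ltn_eqF.
have ac' : a != c by rewrite -val_eqE ltn_eqF.
rewrite orient_gt0_lt0 ?ne //; apply/negP => h.
have o1 := r_nth a b; have o2 := r_nth b c; have o3 := r_nth a c.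
(* A clockwise triple would put its middle vertex inside the triangle formed by [o] and the two
   others. *)
apply: (@vertex_not_in_triangle (nth o l b) o (nth o l a) (nth o l c)).
- exact: nthP.
- by rewrite ne // eq_sym.
- by rewrite ne.
- by rewrite ltW // o1 // a0.
- by rewrite orient_swap_last -oppr_le0 opprK ltW.
- by rewrite 2!orient_cycle ltW // o2 // b0.
- by rewrite o3 // a0.
Qed.

End ConvexPosition.
End PlaneGeometry.

(** * Combinatorics of noncrossing chords, as pairs of naturals *)

Section NoncrossingChords.

Local Open Scope nat_scope.

Implicit Types (d e : nat * nat) (S : seq (nat * nat)).

Definition interleaved d e := [&& d.1 < e.1, e.1 < d.2 & d.2 < e.2].

Definition noncrossing S := forall d e, d \in S -> e \in S -> ~~ interleaved d e.

(** Take for [k] the largest neighbour of [a] below [b], where [a.+1] always counts as a neighbour.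
    A chord passing over [k] either starts at [a], against maximality, or crosses the chord from [a]
    to [k]. *)
Lemma noncrossing_split S a b : a.+1 < b -> noncrossing S ->
  (forall d, d \in S -> d.1.+1 < d.2) ->
  exists k, [/\ a < k < b, (a, k) \in S \/ k = a.+1
    & forall d, d \in S -> a <= d.1 -> d.2 <= b -> d <> (a, b) ->
        d.2 <= k \/ k <= d.1].
Proof.
move=> ab nS pS.
pose P k := [&& a < k, k < b & ((a, k) \in S) || (k == a.+1)].
have exP : exists k, P k by exists a.+1; rewrite /P eqxx orbT andbT; lia.
have ubP k : P k -> k <= b by rewrite /P; lia.
case: (ex_maxnP exP ubP) => k /and3P[ak kb Ek] kmax.
exists k; split; first by rewrite ak.
  by case/orP: Ek => [|/eqP]; [left | right].
move=> [x y] dS /= ax yb dab.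
case: (leqP y k) => [|ky]; first by left.
case: (leqP k x) => [|xk]; first by right.
have := pS _ dS => /= xy.
case: (eqVneq x a) => [xa|xa].
  rewrite xa in dS dab *.
  case: (eqVneq y b) => [yb'|yb']; first by rewrite yb' in dab.
  by have := kmax y; rewrite /P dS /=; lia.
case/orP: Ek => [Ek|/eqP ka]; last by lia.
have := nS _ _ Ek dS; rewrite /interleaved /=; lia.
Qed.

Lemma count_le_split (T : eqType) (s : seq T) (P P1 P2 : pred T) x :
  uniq s -> {in s, forall y, P y -> [\/ y = x, P1 y | P2 y]} ->
  count P s <= 1 + (count P1 s + count P2 s).
Proof.
move=> us H.
have -> : count P s = count (predI P (pred1 x)) s + count (predI P (predC (pred1 x))) s.
  by rewrite -!size_filter !filter_predI -(count_predC (pred1 x) (filter P s))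
    -!size_filter -!filter_predI; congr (_ + _);
    rewrite !size_filter; apply: eq_count => y /=; rewrite andbC.
apply: leq_add.
  apply: (@leq_trans (count (pred1 x) s)).
    by apply: sub_count => y /= /andP[].
  by rewrite count_uniq_mem // leq_b1.
rewrite -(count_predUI P1 P2); apply: leq_trans (leq_addr _ _).
rewrite -2!size_filter; apply: uniq_leq_size; first exact: filter_uniq.
move=> y; rewrite !mem_filter /= => /andP[/andP[Py yx] ys]; rewrite ys andbT.
case: (H y ys Py) => [yE|->|->] //; last by rewrite orbT.
by rewrite yE eqxx in yx.
Qed.

(** Induction through the splitting point [k]: the pair [(a, b)] itself counts for at most 1, and 1
    + (k - a - 1) + (b - k - 1) = b - a - 1. *)
Lemma count_noncrossing S a b : a < b -> uniq S -> noncrossing S ->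
  (forall d, d \in S -> d.1.+1 < d.2) ->
  count (fun d : nat * nat => (a <= d.1) && (d.2 <= b)) S <= (b - a).-1.
Proof.
move=> ab uS nS pS; have [N leN] := ubnP (b - a).
elim: N a b ab leN => // N IH a b ab leN.
case: (ltnP a.+1 b) => [ab1|ba1]; last first.
  rewrite (_ : count _ _ = 0) //; apply/eqP; rewrite -leqn0 leqNgt -has_count.
  have H d : d \in S -> ~~ ((a <= d.1) && (d.2 <= b)) by move=> /pS; lia.
  by apply/hasPn => d /H.
have [k [/andP[ak kb] _ Hk]] := noncrossing_split ab1 nS pS.
have := @count_le_split _ S (fun d : nat * nat => (a <= d.1) && (d.2 <= b))
   (fun d : nat * nat => (a <= d.1) && (d.2 <= k)) (fun d : nat * nat => (k <= d.1) && (d.2 <= b)) (a, b) uS.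
have IH1 := IH a k ak ltac:(lia); have IH2 := IH k b kb ltac:(lia).
have H : (forall d, d \in S -> (a <= d.1) && (d.2 <= b) -> [\/ d = (a, b),
    (a <= d.1) && (d.2 <= k) | (k <= d.1) && (d.2 <= b)]).
  move=> d dS /andP[h1 h2]; case: (eqVneq d (a, b)) => [->|/eqP ne]; first by constructor 1.
  case: (Hk d dS h1 h2 ne) => h; [constructor 2 | constructor 3]; lia.
move=> /(_ H) h; apply: leq_trans h _.
apply: (@leq_trans (1 + ((k - a).-1 + (b - k).-1))); last by lia.
by rewrite leq_add2l; exact: leq_add.
Qed.

Section Maximal.

Variables (n : nat) (S : seq (nat * nat)).
Hypothesis uS : uniq S.
Hypothesis nS : noncrossing S.
Hypothesis chS : forall d, d \in S -> d.1.+1 < d.2 < n.+3 /\ d <> (0, n.+2).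
Hypothesis szS : size S = n.

(** Adding both [d] and the side [(0, n.+2)] would give n + 2 noncrossing pairs, one more than
    [count_noncrossing] allows. *)
Lemma noncrossing_maximal d : d.1.+1 < d.2 < n.+3 -> d <> (0, n.+2) ->
  (forall e, e \in S -> ~~ interleaved d e && ~~ interleaved e d) -> d \in S.
Proof.
move=> dd d0 Hd; apply/negPn/negP => dS.
pose S' := [:: (0, n.+2), d & S].
have uS' : uniq S'.
  rewrite /S' /= dS uS inE !andbT negb_or; apply/andP; split.
    by apply/eqP => e; apply: d0.
  by apply/negP => /chS[].
have pS' : (forall d, d \in S' -> d.1.+1 < d.2).
  move=> e; rewrite !inE => /or3P[/eqP->//|/eqP->|/chS[]]; lia.
have bS' : (forall d, d \in S' -> d.2 < n.+3).
  move=> e; rewrite !inE => /or3P[/eqP->//=|/eqP->|/chS[]]; lia.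
have nS' : noncrossing S'.
  have side e : e.2 < n.+3 -> ~~ interleaved (0, n.+2) e && ~~ interleaved e (0, n.+2).
    by rewrite /interleaved /=; lia.
  move=> e f eS fS; have /andP[fb1 fb2] := side _ (bS' _ fS).
  have /andP[eb1 eb2] := side _ (bS' _ eS).
  move: eS fS; rewrite !inE => /or3P[/eqP eE|/eqP eE|eS]; first by rewrite eE.
    move=> /or3P[/eqP fE|/eqP fE|fS]; first by rewrite fE.
      by rewrite eE fE /interleaved; lia.
    by rewrite eE; case/andP: (Hd _ fS).
  move=> /or3P[/eqP fE|/eqP fE|fS]; first by rewrite fE.
    by rewrite fE; case/andP: (Hd _ eS).
  exact: nS.
have := @count_noncrossing S' 0 n.+2 isT uS' nS' pS'.
rewrite (_ : count _ _ = size S'); first by rewrite /S' /= szS; lia.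
have H e : e \in S' -> (0 <= e.1) && (e.2 <= n.+2) by move=> /bS'; lia.
by apply/eqP; rewrite -all_count; apply/allP => e /H.
Qed.

Definition chord_or_side a b :=
  [|| (a, b) \in S, b == a.+1 | (a == 0) && (b == n.+2)].

Lemma chord_or_side_noncrossing a b d : chord_or_side a b -> d \in S ->
  ~~ interleaved (a, b) d && ~~ interleaved d (a, b).
Proof.
move=> /or3P[ab|/eqP ab|/andP[/eqP-> /eqP->]] dS.
- by rewrite !nS.
- by rewrite /interleaved /=; lia.
- by have [+ _] := chS dS; rewrite /interleaved /=; lia.
Qed.

Lemma chord_or_side_noncross a b x y : chord_or_side a b -> chord_or_side x y ->
  y < n.+3 -> ~ (a < x /\ x < b /\ b < y).
Proof.
move=> /or3P[ab|/eqP ab|/andP[/eqP-> /eqP->]] xy; try lia.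
have := chord_or_side_noncrossing xy ab; rewrite /interleaved /=; lia.
Qed.

(** The splitting point provides the side from [a] to [k]. Nothing in [S] crosses the pair [(k, b)],
    so maximality makes it an edge as well. *)
Lemma inner_triangle a b : a.+1 < b < n.+3 -> chord_or_side a b ->
  exists k, [/\ a < k < b, chord_or_side a k & chord_or_side k b].
Proof.
move=> /andP[ab bn] Eab.
have pS : (forall d, d \in S -> d.1.+1 < d.2) by move=> d /chS[]; lia.
have [k [akb Ek Hk]] := noncrossing_split ab nS pS.
have Eak : chord_or_side a k.
  by case: Ek => [Ek|->]; rewrite /chord_or_side ?Ek ?eqxx ?orbT.
exists k; split => //.
case: (eqVneq b k.+1) => [->|bk]; first by rewrite /chord_or_side eqxx orbT.
apply/or3P; constructor 1; apply: noncrossing_maximal => /=; try (lia || case; lia).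
move=> [x y] dS; have [/= xy _] := chS dS.
have := chord_or_side_noncrossing Eab dS; have := chord_or_side_noncrossing Eak dS.
rewrite /interleaved /= => h1 h2; apply/andP.
case: (eqVneq (x, y) (a, b)) => [[-> ->]|/eqP ne]; first by lia.
have h : a <= x -> y <= b -> y <= k \/ k <= x by move=> ax yb; exact: (Hk _ dS).
by split; apply/negP => h3; lia.
Qed.

(** Let [l] be the next neighbour of 0 after [j]. The apex of the inner triangle on [(0, l)] cannot
    precede [j] without a crossing, nor follow it by minimality of [l], so it is [j]. *)
Lemma outer_triangle j : 0 < j < n.+2 -> chord_or_side 0 j ->
  exists l, [/\ j < l < n.+3, chord_or_side 0 l & chord_or_side j l].
Proof.
move=> /andP[j0 jn] E0j.
pose P l := (j < l) && chord_or_side 0 l.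
have exP : exists l, P l by exists n.+2; rewrite /P /chord_or_side !eqxx !orbT andbT; lia.
case: (ex_minnP exP) => l /andP[jl E0l] lmin.
have ln : l < n.+3.
  by rewrite ltnS; apply: lmin; rewrite /P /chord_or_side !eqxx !orbT andbT; lia.
exists l; split; rewrite ?jl //.
have [|k [/andP[k0 kl] E0k Ekl]] := @inner_triangle 0 l _ E0l; first by lia.
case: (ltngtP k j) => [kj|jk|<-] //.
  by have := chord_or_side_noncross E0j Ekl; lia.
by have := lmin k; rewrite /P jk E0k; lia.
Qed.

(** The new chord joins the apices of the two triangles on [(0, j)]. A chord crossing it is [(0, j)]
    or crosses one of the four sides of the quadrilateral. *)
Lemma noncrossing_flip j : (0, j) \in S ->
  exists k l, [/\ 0 < k < j, j < l < n.+3 &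
    forall d, d \in S -> d <> (0, j) ->
      ~~ interleaved (k, l) d && ~~ interleaved d (k, l)].
Proof.
move=> jS; have [/= j1 j2] := chS jS.
have jn2 : j <> n.+2 by move=> E; apply: j2; rewrite E.
have E0j : chord_or_side 0 j by rewrite /chord_or_side jS.
have [|k [k1 E0k Ekj]] := @inner_triangle 0 j _ E0j; first by lia.
have [|l [l1 E0l Ejl]] := @outer_triangle j _ E0j; first by lia.
exists k, l; split => // -[x y] dS ne.
have [/= xy _] := chS dS.
have := chord_or_side_noncrossing E0k dS; have := chord_or_side_noncrossing Ekj dS.
have := chord_or_side_noncrossing E0l dS; have := chord_or_side_noncrossing Ejl dS.
have : ~ (x = 0 /\ y = j) by move=> [xE yE]; apply: ne; rewrite xE yE.
rewrite /interleaved /=; lia.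
Qed.

End Maximal.

End NoncrossingChords.

(** * From orientations in the plane to positions along the boundary *)

Section PolygonPositions.

Variables (R : realType) (n : nat) (q : 'I_n.+3 -> 'rV[R]_2).
Hypothesis hq : convex_polygon q.

Implicit Types (i j k : 'I_n.+3) (d e : 'I_n.+3 * 'I_n.+3) (T : {set 'I_n.+3 * 'I_n.+3}).

Lemma adjacent_sym i j : adjacent q i j = adjacent q j i.
Proof.
rewrite /adjacent eq_sym orbC; congr (_ && (_ || _)); apply: eq_forallb => k;
  by rewrite (orient_swap (q j)) ?oppr_ge0 ?oppr_le0.
Qed.

(** The affine form defining the line of [d] vanishes at an interior point of [e]. If it vanished at
    an end of [e] it would vanish at both, and [e] would be [d], as no three vertices are
    collinear. *)
Lemma cross_opposite d e : (d.1 < d.2)%N -> (e.1 < e.2)%N -> cross q d e ->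
  orient (q d.1) (q d.2) (q e.1) * orient (q d.1) (q d.2) (q e.2) < 0.
Proof.
case: d e => [i j] [k l] /= ij kl [/= ne [x [y [/andP[x0 x1] /andP[y0 y1] E]]]].
have Z : 0 = (1 - y) * orient (q i) (q j) (q k) + y * orient (q i) (q j) (q l).
  rewrite -orient_affine -E orient_affine.
  by have [-> ->] := orient_same (q i) (q j); rewrite !mulr0 addr0.
have ij' : i != j by rewrite -val_eqE ltn_eqF.
have kl' : k != l by rewrite -val_eqE ltn_eqF.
have on_line h : orient (q i) (q j) (q h) = 0 -> h = i \/ h = j.
  move=> /eqP; case: (eqVneq h i) => [|hi]; first by left.
  case: (eqVneq h j) => [|hj]; first by right.
  by rewrite (negPf (vertices_not_collinear hq _ _ _)) // eq_sym.
case: (eqVneq (orient (q i) (q j) (q k)) 0) => [ok0|ok0].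
  have ol0 : orient (q i) (q j) (q l) = 0.
    by move/eqP: Z; rewrite ok0 mulr0 add0r eq_sym mulf_eq0 gt_eqF //= => /eqP.
  case: (on_line _ ok0) => kE; case: (on_line _ ol0) => lE; subst k l.
  - by rewrite eqxx in kl'.
  - by [].
  - by move: ij kl; lia.
  - by rewrite eqxx in kl'.
have oE : orient (q i) (q j) (q l) = - ((1 - y) / y) * orient (q i) (q j) (q k).
  apply: (mulfI (lt0r_neq0 y0)); rewrite mulNr mulrN mulrA mulrCA divff ?lt0r_neq0 //.
  by rewrite mulr1; lra.
rewrite oE mulrCA -expr2 mulNr oppr_lt0 mulr_gt0 //; last by rewrite exprn_even_gt0.
by rewrite divr_gt0 // subr_gt0.
Qed.

(** On each segment the parameter of the common point is u / (u - v), where u and v are the values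
    at its two ends of the form defining the other line. *)
Lemma opposite_cross d e : d <> e ->
  orient (q d.1) (q d.2) (q e.1) * orient (q d.1) (q d.2) (q e.2) < 0 ->
  orient (q e.1) (q e.2) (q d.1) * orient (q e.1) (q e.2) (q d.2) < 0 ->
  cross q d e.
Proof.
have mul_lt0 (u v : R) : u * v < 0 -> 0 < u / (u - v) < 1 /\ u - v != 0.
  move=> uv; have [u0|u0|u0] := ltrgtP u 0; last by rewrite u0 mul0r ltxx in uv.
    have v0 : 0 < v by rewrite -(nmulr_rlt0 _ u0).
    have D : u - v < 0 by lra.
    split; last by rewrite lt_eqF.
    by rewrite -mulrNN -invrN divr_gt0 ?oppr_gt0 //= ltr_pdivrMr ?oppr_gt0 //; lra.
  have v0 : v < 0 by rewrite -(pmulr_rlt0 _ u0).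
  have D : 0 < u - v by lra.
  split; last by rewrite gt_eqF.
  by rewrite divr_gt0 //= ltr_pdivrMr //; lra.
move=> ne /mul_lt0[ht Dt] /mul_lt0[hs Ds]; split=> //.
do 2 eexists; split; [exact: hs | exact: ht |].
move: Dt Ds; rewrite /orient => Dt Ds.
by apply: point_eq; rewrite !coordE; field; rewrite Dt Ds.
Qed.

Section Sorted.

Variable s : {perm 'I_n.+3}.
Hypothesis hs : ccw_sorted q s.

Definition position i : nat := (s^-1)%g i.

Lemma position_lt i : (position i < n.+3)%N. Proof. exact: ltn_ord. Qed.

Lemma position_inj : injective position.
Proof. by move=> i j /val_inj; apply: perm_inj. Qed.

Lemma position_perm (a : 'I_n.+3) : position (s a) = a.
Proof. by rewrite /position permK. Qed.

Lemma perm_position i (a : 'I_n.+3) : position i = a -> i = s a.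
Proof. by move=> ia; apply: position_inj; rewrite position_perm. Qed.

Lemma position_surj a : (a < n.+3)%N -> exists i, position i = a.
Proof. by move=> an; exists (s (Ordinal an)); rewrite position_perm. Qed.

Lemma orient_position_gt0 i j k :
  (position i < position j < position k)%N -> 0 < orient (q i) (q j) (q k).
Proof.
move=> /andP[ij jk]; have := hs ij jk.
by rewrite /position !permKV.
Qed.

Definition cyclic3 a b c := [|| a < b < c, b < c < a | c < a < b]%N.

(** Three distinct positions are in exactly one of the two cyclic orders, and [ccw_sorted] gives the
    sign for each. From here on, geometric statements about vertices become integer arithmetic. *)
Lemma orient_cyclic i j k : i != j -> j != k -> i != k ->
  (0 < orient (q i) (q j) (q k)) = cyclic3 (position i) (position j) (position k).
Proof.
have pos_cyc x y z : cyclic3 (position x) (position y) (position z) ->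
    0 < orient (q x) (q y) (q z).
  case/or3P => h; first exact: orient_position_gt0.
    by rewrite -orient_cycle orient_position_gt0.
  by rewrite orient_cycle orient_position_gt0.
move=> ij jk ik; apply/idP/idP; last exact: pos_cyc.
move=> h; apply/negPn/negP => nc; have : 0 < orient (q j) (q i) (q k).
  apply: pos_cyc; move: nc ij jk ik.
  rewrite -!(inj_eq position_inj) /cyclic3; lia.
by rewrite orient_swap oppr_gt0; apply/negP; rewrite -leNgt ltW.
Qed.

Lemma orient_cyclic_neg i j k : i != j -> j != k -> i != k ->
  (orient (q i) (q j) (q k) < 0) = cyclic3 (position j) (position i) (position k).
Proof.
move=> ij jk ik; have ji : j != i by rewrite eq_sym.
by rewrite -orient_cyclic // (orient_swap (q i)) oppr_gt0.
Qed.

Lemma opposite_cyclic i j k l : i != j -> k != i -> k != j -> l != i -> l != j ->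
  (orient (q i) (q j) (q k) * orient (q i) (q j) (q l) < 0) =
  (cyclic3 (position i) (position j) (position k)
     != cyclic3 (position i) (position j) (position l)).
Proof.
move=> ij ki kj li lj.
have [ik jk il jl] : [/\ i != k, j != k, i != l & j != l] by split; rewrite eq_sym.
rewrite -!orient_cyclic //.
have := vertices_not_collinear hq ij jl il; have := vertices_not_collinear hq ij jk ik.
set u := orient _ _ _; set v := orient _ _ _.
case: (ltrgtP u 0) => // u0 _; case: (ltrgtP v 0) => // v0 _.
- by rewrite nmulr_rlt0 // ltNge ltW.
- by rewrite nmulr_rlt0.
- by rewrite pmulr_rlt0.
- by rewrite pmulr_rlt0 // ltNge ltW.
Qed.

Lemma adjacent_position i j : (position i < position j)%N ->
  adjacent q i j = (position j == (position i).+1)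
                || (position i == 0) && (position j == n.+2).
Proof.
move=> ij; have ij' : i != j by rewrite -(inj_eq position_inj) ltn_eqF.
have jn := position_lt j.
rewrite /adjacent ij' /=; congr (_ || _); apply/idP/idP.
- move=> /forallP h; apply/negPn/negP => nj.
  (* The vertex just after [i], when it is not [j], lies strictly to the right of the line from [i]
     to [j]. *)
  have [k kE] := @position_surj (position i).+1 ltac:(lia).
  have := h k; rewrite leNgt orient_cyclic_neg //; rewrite -?(inj_eq position_inj) kE /cyclic3; lia.
- move=> /eqP jE; apply/forallP => k.
  case: (eqVneq k i) => [->|ki]; first by have [-> _] := orient_same (q i) (q j).
  case: (eqVneq k j) => [->|kj]; first by have [_ ->] := orient_same (q i) (q j).
  rewrite leNgt orient_cyclic_neg //; try (by rewrite eq_sym).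
  move: ki kj; rewrite -!(inj_eq position_inj) /cyclic3; lia.
- move=> /forallP h; apply/negPn/negP => nj.
  (* A vertex positioned outside the interval from [i] to [j] lies to the left of the line: the last
     one if [i] comes first, the first one otherwise. *)
  have [k [kE kij]] : exists k, position k != position i /\
      ((position k < position i)%N \/ (position j < position k)%N).
    case: (posnP (position i)) => [i0|i0].
      by have [k kE] := @position_surj n.+2 (ltnSn _); exists k; rewrite kE; lia.
    by have [k kE] := @position_surj 0 (ltn0Sn _); exists k; rewrite kE; lia.
  have := h k; rewrite leNgt orient_cyclic //; rewrite -?(inj_eq position_inj) /cyclic3; lia.
- move=> /andP[/eqP i0 /eqP jE]; apply/forallP => k.
  case: (eqVneq k i) => [->|ki]; first by have [-> _] := orient_same (q i) (q j).
  case: (eqVneq k j) => [->|kj]; first by have [_ ->] := orient_same (q i) (q j).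
  rewrite leNgt orient_cyclic //; try (by rewrite eq_sym).
  have := position_lt k; move: ki kj; rewrite -!(inj_eq position_inj) /cyclic3; lia.
Qed.

(** Sorted anew, since a diagonal is ordered by labels and these need not increase along the
    boundary. *)
Definition chord_position d :=
  (minn (position d.1) (position d.2), maxn (position d.1) (position d.2)).

Lemma chord_position_inj d e : (d.1 < d.2)%N -> (e.1 < e.2)%N ->
  chord_position d = chord_position e -> d = e.
Proof.
case: d e => [i j] [k l] /= ij kl [mE ME].
have [[h1 h2]|[h1 h2]] : (position i = position k /\ position j = position l)
    \/ (position i = position l /\ position j = position k) by lia.
  by rewrite (position_inj h1) (position_inj h2).
by move: ij kl; rewrite (position_inj h1) (position_inj h2); lia.
Qed.

Lemma diagonal_chord_position d : Defs.diagonal q d ->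
  ((chord_position d).1.+1 < (chord_position d).2 < n.+3)%N
  /\ chord_position d <> (0, n.+2)%N.
Proof.
case: d => [i j] /andP[/= ij]; have i3 := position_lt i; have j3 := position_lt j.
have ne : position i <> position j by move/position_inj => E; rewrite E ltnn in ij.
rewrite /chord_position /=; case: (ltngtP (position i) (position j)) => h //.
  rewrite adjacent_position // => /norP[h1 h2]; split; first by lia.
  by move=> [e1 e2]; rewrite e1 e2 !eqxx in h2.
rewrite adjacent_sym adjacent_position // => /norP[h1 h2]; split; first by lia.
by move=> [e1 e2]; rewrite e1 e2 !eqxx in h2.
Qed.

Lemma cross_position d e : (d.1 < d.2)%N -> (e.1 < e.2)%N ->
  cross q d e <-> interleaved (chord_position d) (chord_position e)
               || interleaved (chord_position e) (chord_position d).
Proof.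
have opp i j k l : orient (q i) (q j) (q k) * orient (q i) (q j) (q l) < 0 ->
   [/\ k != i, k != j, l != i & l != j].
  have [z1 z2] := orient_same (q i) (q j).
  by move=> h; split; apply: contraTneq h => ->; rewrite ?z1 ?z2 ?mul0r ?mulr0 ltxx.
case: d e => [i j] [k l] /= ij kl.
have ij' : i != j by rewrite -val_eqE ltn_eqF.
have kl' : k != l by rewrite -val_eqE ltn_eqF.
have jn := position_lt j.
split=> h.
  have h' := cross_opposite (d := (i, j)) (e := (k, l)) ij kl h.
  have [ki kj li lj] := opp _ _ _ _ h'; move: h' => /=.
  rewrite opposite_cyclic //; move: ij' kl' ki kj li lj.
  rewrite -!(inj_eq position_inj) /cyclic3 /interleaved /=; lia.
have [ki kj li lj] : [/\ k != i, k != j, l != i & l != j].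
  by split; apply/eqP => E; move: h; rewrite E /interleaved /=; lia.
apply: opposite_cross.
- by move=> [E _]; rewrite E eqxx in ki.
- rewrite /= opposite_cyclic //; move: h ij' kl' ki kj li lj.
  rewrite -!(inj_eq position_inj) /cyclic3 /interleaved /=; lia.
- rewrite /= opposite_cyclic //; try by rewrite eq_sym.
  move: h ij' kl' ki kj li lj.
  rewrite -!(inj_eq position_inj) /cyclic3 /interleaved /=; lia.
Qed.

End Sorted.

End PolygonPositions.

(** * Maximality and flips of triangulations *)

Section Triangulations.

Variables (R : realType) (n : nat) (q : 'I_n.+3 -> 'rV[R]_2).
Hypothesis hq : convex_polygon q.

Implicit Types (i j k : 'I_n.+3) (d e : 'I_n.+3 * 'I_n.+3) (T : {set 'I_n.+3 * 'I_n.+3}).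

Definition edge T i j := [|| adjacent q i j, (i, j) \in T | (j, i) \in T].

Definition chord_positions (s : {perm 'I_n.+3}) T := [seq chord_position s d | d <- enum T].

Lemma triangulation_lt T d : triangulation q T -> d \in T -> (d.1 < d.2)%N.
Proof. by move=> [_ h _] /h /andP[]. Qed.

Section Positions.

Variables (s : {perm 'I_n.+3}) (T : {set 'I_n.+3 * 'I_n.+3}).
Hypothesis hs : ccw_sorted q s.
Hypothesis hT : triangulation q T.

Let pos := position s.
Let S := chord_positions s T.

Lemma chord_positionsP d : (d.1 < d.2)%N -> (chord_position s d \in S) = (d \in T).
Proof.
move=> dd; apply/mapP/idP => [[e]|dT]; last by exists d; rewrite ?mem_enum.
rewrite mem_enum => eT /(chord_position_inj dd) -> //.
exact: triangulation_lt hT eT.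
Qed.

Lemma uniq_chord_positions : uniq S.
Proof.
rewrite map_inj_in_uniq ?enum_uniq // => d e; rewrite !mem_enum => dT eT.
by apply: chord_position_inj; apply: triangulation_lt hT _.
Qed.

Lemma size_chord_positions : size S = n.
Proof. by rewrite size_map -cardE; case: hT. Qed.

Lemma noncrossing_chord_positions : noncrossing S.
Proof.
move=> x y /mapP[d + ->] /mapP[e + ->]; rewrite !mem_enum => dT eT.
apply/negP => h; have [_ _ /(_ _ _ dT eT)] := hT; apply.
by apply/(cross_position hq hs); rewrite ?h //; apply: triangulation_lt hT _.
Qed.

Lemma diagonal_chord_positions x : x \in S ->
  (x.1.+1 < x.2 < n.+3)%N /\ x <> (0, n.+2)%N.
Proof.
move=> /mapP[d + ->]; rewrite mem_enum => dT.
by have [_ /(_ _ dT) dd _] := hT; exact: (diagonal_chord_position hs dd).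
Qed.

Lemma mem_chord_positions i j : (pos i < pos j)%N ->
  ((pos i, pos j) \in S) = ((i, j) \in T) || ((j, i) \in T).
Proof.
move=> ij; case: (ltngtP i j) => ij'; last by rewrite (val_inj ij') ltnn in ij.
  have -> : (pos i, pos j) = chord_position s (i, j).
    by rewrite /chord_position /= -/pos; congr (_, _); lia.
  rewrite chord_positionsP //; case: (boolP ((j, i) \in T)) => [|_]; last by rewrite orbF.
  by move/(triangulation_lt hT) => /=; lia.
have -> : (pos i, pos j) = chord_position s (j, i).
  by rewrite /chord_position /= -/pos; congr (_, _); lia.
rewrite chord_positionsP //; case: (boolP ((i, j) \in T)) => [|_] //.
by move/(triangulation_lt hT) => /=; lia.
Qed.

Lemma edge_position i j : (pos i < pos j)%N ->
  edge T i j = chord_or_side n S (pos i) (pos j).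
Proof.
move=> ij; rewrite /edge /chord_or_side mem_chord_positions // (adjacent_position hs) //.
by rewrite orbC.
Qed.

End Positions.

Lemma edge_sym T i j : edge T i j = edge T j i.
Proof. by rewrite /edge adjacent_sym; congr (_ || _); exact: orbC. Qed.

Lemma diagonal_position s d : ccw_sorted q s -> (d.1 < d.2)%N ->
  ((chord_position s d).1.+1 < (chord_position s d).2 < n.+3)%N ->
  chord_position s d <> (0, n.+2)%N -> Defs.diagonal q d.
Proof.
case: d => i j hs /= ij; rewrite /Defs.diagonal /= ij /=.
rewrite /chord_position /= => /andP[h1 h2] h3.
case: (ltngtP (position s i) (position s j)) h1 h2 h3 => h h1 h2 h3; last by lia.
  rewrite (adjacent_position hs) //; apply/norP; split; first by lia.
  by apply/negP => /andP[/eqP e1 /eqP e2]; apply: h3; rewrite e1 e2.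
rewrite adjacent_sym (adjacent_position hs) //; apply/norP; split; first by lia.
by apply/negP => /andP[/eqP e1 /eqP e2]; apply: h3; rewrite e1 e2.
Qed.

Lemma triangulation_maximal T d : triangulation q T -> Defs.diagonal q d ->
  (forall e, e \in T -> ~ cross q d e) -> d \in T.
Proof.
move=> hT dd hd; have [s [hs _]] := exists_ccw_sorted hq ord0.
have d12 : (d.1 < d.2)%N by case/andP: dd.
rewrite -(chord_positionsP s hT d12).
have [h1 h2] := diagonal_chord_position hs dd.
apply: (@noncrossing_maximal n) => //.
- exact: uniq_chord_positions.
- exact: noncrossing_chord_positions.
- exact: diagonal_chord_positions.
- exact: size_chord_positions.
- move=> x /mapP[e + ->]; rewrite mem_enum => eT.
  rewrite -negb_or; apply/negP => /(cross_position hq hs d12 (triangulation_lt hT eT)).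
  exact: hd.
Qed.

Lemma cross_sym d e : cross q d e -> cross q e d.
Proof.
by move=> [ne [x [y [hx hy E]]]]; split; [apply: nesym | exists y, x; split].
Qed.

Lemma triangulation_flip T d : triangulation q T -> d \in T ->
  exists d', [/\ d' \notin T, (d'.1 < d'.2)%N, triangulation q (d' |: T :\ d)%SET,
    cross q d' d & forall e, e \in T -> e != d -> ~ cross q d' e].
Proof.
(* Enumerating from an end of [d] makes [d] a chord [(0, j)], the only case treated by
   [noncrossing_flip]. *)
move=> hT dT; have [s [hs s0]] := exists_ccw_sorted hq d.1.
have d12 := triangulation_lt hT dT.
have d0 : position s d.1 = 0%N by rewrite -(s0 ord0) // position_perm.
have dE : chord_position s d = (0, position s d.2)%N.
  by rewrite /chord_position d0 min0n max0n.
have dS : (0, position s d.2)%N \in chord_positions s T by rewrite -dE (chord_positionsP s hT).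
have [k [l [kj jl Hkl]]] := noncrossing_flip (uniq_chord_positions s hT)
  (noncrossing_chord_positions hs hT) (diagonal_chord_positions hs hT)
  (size_chord_positions s hT) dS.
have [x xE] := @position_surj _ s k ltac:(lia).
have [y yE] := @position_surj _ s l ltac:(lia).
have xy : x <> y by move=> E; move: xE yE; rewrite E; lia.
have [d' [d'12 d'E]] : exists d', (d'.1 < d'.2)%N /\ chord_position s d' = (k, l).
  case: (ltngtP x y) => [h|h|/val_inj //].
    by exists (x, y); split; rewrite // /chord_position /= xE yE; congr (_, _); lia.
  by exists (y, x); split; rewrite // /chord_position /= xE yE; congr (_, _); lia.
have d'd : cross q d' d.
  by apply/(cross_position hq hs d'12 d12); rewrite d'E dE /interleaved /=; lia.
have d'T : d' \notin T.
  by apply/negP => d'T; have [_ _ /(_ _ _ d'T dT)] := hT; apply.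
have d'e e : e \in T -> e != d -> ~ cross q d' e.
  move=> eT ed; have e12 := triangulation_lt hT eT.
  move/(cross_position hq hs d'12 e12); rewrite d'E; apply/negP.
  rewrite negb_or; apply: Hkl; first by rewrite (chord_positionsP s hT).
  by rewrite -dE => /(chord_position_inj e12 d12) E; rewrite E eqxx in ed.
exists d'; split => //; have [cT diT nT] := hT; split.
- by rewrite cardsU1 !inE (negPf d'T) andbF -[RHS]cT (cardsD1 d T) dT.
- move=> e; rewrite !inE => /orP[/eqP->|/andP[_ /diT //]].
  by apply: (diagonal_position hs d'12); rewrite d'E /=; [lia | move=> [k0 _]; rewrite k0 in kj].
- move=> e f; rewrite !inE => /orP[/eqP->|/andP[ed eT]] /orP[/eqP->|/andP[fd fT]].
  + by case.
  + exact: d'e.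
  + by move/cross_sym; apply: d'e.
  + exact: nT.
Qed.

End Triangulations.

(** * Rays of normal fans and their transfer under isomorphism *)

Section OppositeRays.

Variable R : realType.

Implicit Types (E : vectType R).

(** Expresses that [c] spans a ray of the normal fan: up to lineality, only its nonnegative
    multiples are normal to its maximal face. Nonemptiness is part of the condition because a form
    need not attain a maximum on an arbitrary set. *)
Definition ray_form E (P : set E) (c : 'Hom(E, R^o)) : Prop :=
  [/\ max_face P c !=set0, ~ lineality (normal_fan P) c
    & forall d, normal_cone P (max_face P c) d ->
        exists2 t : R, 0 <= t & lineality (normal_fan P) (d - t *: c)].

Definition opposite_rays E (P : set E) : Prop :=
  exists c, ray_form P c /\ ray_form P (- c).

(** A form [c] such that [c] and [- c] are both maximal on a face is constant. Some face must exist,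
    for the lineality space of an empty fan is the whole space. *)
Lemma linealityP E (P G : set E) (c : 'Hom(E, R^o)) : is_face P G ->
  lineality (normal_fan P) c <-> forall x y, P x -> P y -> c x = c y.
Proof.
move=> fG; split=> [Lc|cP C [F [_ [d FE]] <-]]; last first.
  split=> x; rewrite {}FE => -[Px _]; split=> // y Py; rewrite ?opp_lfunE.
    by rewrite (cP _ _ Py Px).
  by rewrite (cP _ _ Py Px).
have [h1 h2] : normal_cone P G c /\ normal_cone P G (- c) by apply: Lc; exists G.
have [[g Gg] _] := fG; have [_ h3] := h1 _ Gg; have [_ h4] := h2 _ Gg.
suff H y : P y -> c y = c g by move=> x y Px Py; rewrite !H.
move=> Py; apply/eqP; rewrite eq_le h3 //=.
by have := h4 _ Py; rewrite !opp_lfunE lerN2.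
Qed.

Lemma max_face_is_face E (P : set E) c : max_face P c !=set0 -> is_face P (max_face P c).
Proof. by move=> h; split=> //; exists c. Qed.

Lemma conv_hull_sub (E : lmodType R) (A : set E) : A `<=` conv_hull A.
Proof.
move=> a Aa; exists 1, (fun=> 1), (fun=> a); split => //.
  by rewrite big_ord1.
by rewrite big_ord1 scale1r.
Qed.

Lemma conv_hull_le E (A : set E) (c : 'Hom(E, R^o)) (M : R) :
  (forall a, A a -> (c a : R) <= M) -> forall x, conv_hull A x -> (c x : R) <= M.
Proof.
move=> cA x [k [w [a [w0 w1 Aa ->]]]].
rewrite linear_sum /= -[leRHS]mul1r -w1 mulr_suml.
by apply: ler_sum => i _; rewrite linearZ /=; apply: ler_wpM2l => //; apply: cA.
Qed.

Lemma exists_seq_max (T : eqType) (s : seq T) (f : T -> R) : s != [::] ->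
  exists2 a, a \in s & forall b, b \in s -> f b <= f a.
Proof.
elim: s => // x s IH _; case: (eqVneq s [::]) => [->|/IH [a sa ha]].
  by exists x; rewrite ?mem_head // => b; rewrite inE => /eqP->.
have [xa|ax] := lerP (f x) (f a).
  by exists a; rewrite ?inE ?sa ?orbT // => b; rewrite inE => /orP[/eqP->|/ha].
exists x; rewrite ?mem_head // => b; rewrite inE => /orP[/eqP->//|/ha h].
exact: le_trans h (ltW ax).
Qed.

(** The factor is a minimum of the ratios f / g over the elements with g positive; there f is
    positive too, by the second hypothesis. *)
Lemma exists_small_factor (T : eqType) (s : seq T) (f g : T -> R) :
  (forall b, b \in s -> 0 <= f b) -> (forall b, b \in s -> f b = 0 -> g b <= 0) ->
  exists2 eps : R, 0 < eps & forall b, b \in s -> eps * g b <= f b.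
Proof.
elim: s => [|x s IH] f0 fg; first by exists 1.
have [||eps e0 he] := IH; first by move=> b bs; apply: f0; rewrite inE bs orbT.
  by move=> b bs; apply: fg; rewrite inE bs orbT.
have fx := f0 x (mem_head _ _).
have [gx|gx] := lerP (g x) 0.
  exists eps => // b; rewrite inE => /orP[/eqP->|/he//].
  by apply: le_trans fx; rewrite pmulr_rle0.
have fx0 : 0 < f x.
  rewrite lt_neqAle fx andbT eq_sym; apply/eqP => fx0.
  by have := fg x (mem_head _ _) fx0; rewrite leNgt gx.
exists (Num.min eps (f x / g x)); first by rewrite lt_min e0 divr_gt0.
move=> b; rewrite inE => /orP[/eqP->|bs].
  by rewrite -ler_pdivlMr // ge_min lexx orbT.
have [gb|gb] := lerP (g b) 0.
  apply: le_trans (f0 b _); last by rewrite inE bs orbT.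
  by rewrite pmulr_rle0 // lt_min e0 divr_gt0.
by apply: le_trans (he b bs); rewrite ler_pM2r // ge_min lexx.
Qed.

Section Polytope.

Variables (E : vectType R) (s : seq E).

Let P : set E := conv_hull [set` s].

Lemma polytope_max_face (c : 'Hom(E, R^o)) : P !=set0 ->
  exists a, a \in s /\ max_face P c a.
Proof.
move=> [x [k [w [a [_ w1 sa _]]]]].
have sn : s != [::].
  case: k w a w1 sa => [|k] w a w1 sa.
    by move/eqP: w1; rewrite big_ord0 eq_sym oner_eq0.
  by apply: contraTneq (sa ord0) => ->.
have [b bs hb] := exists_seq_max (fun x => c x : R) sn.
exists b; split => //; split; first exact: conv_hull_sub.
by apply: conv_hull_le => y ys; apply: hb.
Qed.

(* [c] is a relative interior point of the normal cone of its maximal face. *)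
Lemma polytope_normal_cone_interior (c e : 'Hom(E, R^o)) :
  P !=set0 -> normal_cone P (max_face P c) e ->
  exists2 eps : R, 0 < eps & normal_cone P (max_face P c) (c - eps *: e).
Proof.
move=> P0 ce; have [a [sa ca]] := polytope_max_face c P0.
have [_ ea] := ce _ ca; have [_ ca'] := ca.
have [||eps e0 heps] := @exists_small_factor _ s (fun b => c a - c b : R) (fun b => e a - e b : R).
- by move=> b bs; rewrite subr_ge0; apply: ca'; apply: conv_hull_sub.
- move=> b bs /eqP; rewrite subr_eq0 => /eqP cab.
  have /ce [_ eb] : max_face P c b.
    by split; [exact: conv_hull_sub | move=> y Py; rewrite -cab; apply: ca'].
  by rewrite subr_le0; apply: eb; exact: ca.1.
exists eps => // x cx; have [Px cx'] := cx; have [_ ex] := ce _ cx.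
split=> // y Py.
have xa : (c x : R) = c a by apply/eqP; rewrite eq_le ca' //= cx' //; exact: ca.1.
have xe : (e x : R) = e a by apply/eqP; rewrite eq_le ea //= ex //; exact: ca.1.
move: y Py; apply: conv_hull_le => b bs.
rewrite !add_lfunE !opp_lfunE !scale_lfunE xa xe.
have := heps b bs; rewrite mulrBr /GRing.scale /=; lra.
Qed.

End Polytope.

Lemma normal_cone_lineality E (P G : set E) (c l : 'Hom(E, R^o)) : is_face P G ->
  normal_cone P G c -> lineality (normal_fan P) l -> normal_cone P G (c + l).
Proof.
move=> fG cG /(linealityP _ fG) lP x /cG [Px cx]; split=> // y Py.
by rewrite !add_lfunE (lP _ _ Py Px) lerD2r cx.
Qed.

(** The normal cone of the maximal face of [c] is mapped onto the normal cone of some face [G] of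
    [P'], about which only the presence of [c'] is known. Once this cone is shown to consist of
    forms normal to the maximal face of [c'], it lies in the ray of [c'], and injectivity of [f]
    brings this back to [c]. *)
Lemma ray_form_transfer E E' (V V' : vectType R) (s : seq E) (P' : set E')
    (p : 'Hom('Hom(E, R^o), V)) (p' : 'Hom('Hom(E', R^o), V')) (f : 'Hom(V, V'))
    (c : 'Hom(E, R^o)) (c' : 'Hom(E', R^o)) :
  let P := conv_hull [set` s] in
  (forall c, p c = 0 <-> lineality (normal_fan P) c) ->
  (forall c, p' c = 0 <-> lineality (normal_fan P') c) ->
  injective f ->
  (forall C, normal_fan P C ->
     exists2 C', normal_fan P' C' & p' @` C' = f @` (p @` C)) ->
  f (p c) = p' c' -> ray_form P' c' -> ray_form P c.
Proof.
move=> P pL pL' finj fF fE [ne' nL' ray'].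
have nL : ~ lineality (normal_fan P) c.
  by move/pL => pc; apply: nL'; apply/pL'; rewrite -fE pc linear0.
have P0 : P !=set0.
  apply: contrapT => P0; apply: nL => C [F [[x Fx] [d FE]] _].
  by exfalso; apply: P0; exists x; move: Fx; rewrite FE => -[].
have [a [_ ca]] := polytope_max_face c P0.
have mc : max_face P c !=set0 by exists a.
split => // d cd.
have [C' [G fG <-] C'E] := fF _ (ex_intro2 _ _ _ (max_face_is_face mc) erefl).
have C'P e : normal_cone P (max_face P c) e ->
    exists2 e', normal_cone P' G e' & p' e' = f (p e).
  move=> ce; have : (p' @` normal_cone P' G) (f (p e)).
    by rewrite C'E; exists (p e) => //; exists e.
  by move=> [e' ? ?]; exists e'.
have absorb e e' : normal_cone P' G e -> p' e = p' e' -> normal_cone P' G e'.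
  move=> Ge ee; have -> : e' = e + (e' - e) by rewrite addrC subrK.
  by apply: (normal_cone_lineality fG) => //; apply/pL'; rewrite linearB /= ee subrr.
(* As [c] is relatively interior, [c' - eps *: e'] is still normal to [G]. At a point of [G] both it
   and [e'] are maximal; comparing with a maximal point [x] of [c'] shows that [e'] is maximal at
   [x] as well. *)
have face_le e' : normal_cone P' G e' -> normal_cone P' (max_face P' c') e'.
  move=> Ge'.
  have [e ce pe] : exists2 e, normal_cone P (max_face P c) e & p' e' = f (p e).
    have : (f @` (p @` normal_cone P (max_face P c))) (p' e') by rewrite -C'E; exists e'.
    by move=> [_ [e ce <-] <-]; exists e.
  have [eps e0 h] := polytope_normal_cone_interior P0 ce.
  have [b Gb pb] := C'P _ h.
  have Gc : normal_cone P' G (c' - eps *: e').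
    by apply: absorb Gb _; rewrite pb !(linearB, linearZ) /= fE pe.
  move=> x [Px cx]; split=> // y Py.
  have [[g Gg] _] := fG.
  have [Pg ceg] := Gc _ Gg; have [_ eg] := Ge' _ Gg.
  apply: le_trans (eg _ Py) _.
  have h1 := cx _ Pg; have := ceg _ Px.
  rewrite !add_lfunE !opp_lfunE !scale_lfunE /GRing.scale /= => h2.
  have h3 : eps * e' g <= eps * e' x by move: h1 h2; lra.
  by rewrite ler_pM2l in h3.
have [e' Ge' pe'] := C'P _ cd.
have [t t0 /pL'] := ray' _ (face_le _ Ge').
rewrite linearB linearZ /= => /eqP; rewrite subr_eq0 pe' -fE => /eqP E1.
exists t => //; apply/pL; apply: finj; rewrite linearB linearZ /= linearB linearZ /= !linear0.
by rewrite E1 subrr.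
Qed.

Lemma opposite_rays_transfer E E' (s : seq E) (P' : set E') :
  normally_isomorphic (conv_hull [set` s]) P' -> opposite_rays P' ->
  opposite_rays (conv_hull [set` s]).
Proof.
move=> [V [V' [F [F' [[p [psurj pL FE]] [p' [_ pL' FE']] [f [bf fF]]]]]]] [c' [rc rc']].
have [g fK gK] := bf.
have [c cE] := psurj (g (p' c')).
have fc : f (p c) = p' c' by rewrite cE gK.
have H C : normal_fan (conv_hull [set` s]) C ->
     exists2 C', normal_fan P' C' & p' @` C' = f @` (p @` C).
  move=> hC; have : F' (f @` (p @` C)) by apply: fF; rewrite FE; exists C.
  by rewrite FE' => -[C' ? ?]; exists C'.
exists c; split; first exact: (ray_form_transfer pL pL' (can_inj fK) H fc).
apply: (ray_form_transfer pL pL' (can_inj fK) H _ rc').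
by rewrite !linearN /= fc.
Qed.

Lemma ray_form_of_fan E (V : vectType R) (P : set E) (F : set (set V))
    (p : 'Hom('Hom(E, R^o), V)) (c : 'Hom(E, R^o)) :
  (forall c, p c = 0 <-> lineality (normal_fan P) c) ->
  F = [set p @` C | C in normal_fan P] -> p c != 0 ->
  F [set x | exists2 t : R, 0 <= t & x = t *: p c] -> ray_form P c.
Proof.
move=> pL -> pc0 [_ [G fG <-] CE].
have [[g Gg] [d GE]] := fG.
have inP : G `<=` P by rewrite GE => x [].
have Gd : normal_cone P G d by rewrite GE.
have cone e : normal_cone P G e -> exists2 t : R, 0 <= t & p e = t *: p c.
  move=> Ge; have : (p @` normal_cone P G) (p e) by exists e.
  by rewrite CE.
have [t t0 pd] := cone _ Gd.
have L_const e : p e = 0 -> forall x y, P x -> P y -> e x = e y.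
  by move/pL/(linealityP _ fG).
(* If [t] were 0, the form [d] defining the face would be constant on [P], so [G] would be all of
   [P] and its normal cone would be the lineality space, which [p] kills; but that cone contains a
   form with image [p c]. *)
have tpos : 0 < t.
  rewrite lt_neqAle t0 andbT; apply/eqP => t00.
  have dconst : forall x y, P x -> P y -> d x = d y.
    by apply: L_const; rewrite pd -t00 scale0r.
  have : (p @` normal_cone P G) (p c) by rewrite CE; exists 1; rewrite ?ler01 ?scale1r.
  move=> [e Ge pe]; move/eqP: pc0; apply; rewrite -pe; apply/pL/(linealityP _ fG).
  have Pmax x : P x -> max_face P e x.
    by move=> Px; apply: Ge; rewrite GE; split=> // y Py; rewrite (dconst _ _ Py Px).
  move=> x y Px Py; apply/eqP; rewrite eq_le.
  by rewrite (Pmax _ Py).2 // (Pmax _ Px).2.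
have dc x y : P x -> P y -> (d y <= d x :> R) = (c y <= c x :> R).
  move=> Px Py; have : (d - t *: c) x = (d - t *: c) y.
    by apply: L_const => //; rewrite linearB linearZ /= pd subrr.
  rewrite !add_lfunE !opp_lfunE !scale_lfunE /GRing.scale /= => E1.
  rewrite -[RHS](ler_pM2l tpos) -[LHS](lerD2r (- (t * c x))).
  by rewrite [in LHS]E1 lerD2l lerN2.
have Gc : G = max_face P c.
  rewrite GE; apply/seteqP; split=> x [Px h]; split=> // y Py.
    by rewrite -dc // h.
  by rewrite dc // h.
split; first by rewrite -Gc; exists g.
  by move/pL => E1; rewrite E1 eqxx in pc0.
move=> e; rewrite -Gc => /cone [u u0 pe]; exists u => //; apply/pL.
by rewrite linearB linearZ /= pe subrr.
Qed.

End OppositeRays.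

(** * Opposite rays in Santos fans *)

Section Santos.

Variables (R : realType) (n : nat) (q : 'I_n.+3 -> 'rV[R]_2).
Hypothesis hq : convex_polygon q.

Lemma cone_generated1 (V : lmodType R) (I : finType) (i : I) (v : I -> V) :
  cone_generated [set i]%SET v = [set x | exists2 t : R, 0 <= t & x = t *: v i].
Proof.
apply/seteqP; split=> x.
  by move=> [w [w0 ->]]; exists (w i) => //; rewrite big_set1.
by move=> [t t0 ->]; exists (fun=> t); split=> //; rewrite big_set1.
Qed.

Lemma AssII_opposite_rays (T : {set 'I_n.+3 * 'I_n.+3}) (E : vectType R) (P : set E) :
  (0 < n)%N -> triangulation q T -> is_AssII q T P -> opposite_rays P.
Proof.
move=> n0 hT [_ [V [alpha [delta [balpha TE [p [psurj pL FE]]]]]]].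
have udelta : uniq delta.
  have [cT _ _] := hT; apply/card_uniqP; rewrite size_tuple -[RHS]cT TE.
  by apply: eq_card => d; rewrite inE.
have delta_inj i j : tnth delta i = tnth delta j -> i = j by move/tuple_uniqP: udelta; apply.
pose i0 : 'I_n := Ordinal n0; set d := tnth delta i0.
have dT : d \in T by rewrite TE inE mem_tnth.
have [d' [d'T _ hT' d'd d'e]] := triangulation_flip hq hT dT.
have vd : santos_vector q alpha delta d = - tnth alpha i0.
  rewrite /santos_vector; case: pickP => [i /eqP /delta_inj -> //|/(_ i0)].
  by rewrite eqxx.
(* The flipped diagonal crosses [d] and no other diagonal of [T], so its sum has a single term. *)
have vd' : santos_vector q alpha delta d' = tnth alpha i0.
  rewrite /santos_vector; case: pickP => [i /eqP dE|_].
    by move: d'T; rewrite -dE TE inE mem_tnth.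
  apply: big_pred1 => i /=; apply/asboolP/eqP => [ci|->] //.
  apply: contrapT => ne; apply: d'e ci; first by rewrite TE inE mem_tnth.
  by apply/eqP => /delta_inj.
have [c cE] := psurj (tnth alpha i0).
have a0 : tnth alpha i0 != 0.
  exact: (free_not0 (basis_free balpha) (mem_tnth i0 alpha)).
exists c; split.
  apply: (ray_form_of_fan pL FE); rewrite cE //.
  exists (d' |: T :\ d)%SET, [set d']%SET; split=> //; first by rewrite finset.sub1set !inE eqxx.
  by rewrite cone_generated1 vd'.
apply: (ray_form_of_fan pL FE); rewrite linearN /= cE ?oppr_eq0 //.
exists T, [set d]%SET; split=> //; first by rewrite finset.sub1set.
by rewrite cone_generated1 vd.
Qed.

End Santos.

(** * Linear forms in coordinates and Hohlweg-Lange associahedra *)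

Section RowForm.

Variables (R : realType) (m : nat).

Definition row_form (g : 'I_m -> R) (x : 'rV[R]_m) : R^o := \sum_l g l * x 0 l.

Fact row_form_linear g : linear (row_form g).
Proof.
move=> a x y; rewrite /row_form scaler_sumr -big_split /=.
by apply: eq_bigr => l _; rewrite !mxE mulrDr mulrCA.
Qed.

HB.instance Definition _ g := GRing.isLinear.Build R 'rV[R]_m R^o _ (row_form g) (row_form_linear g).

Definition row_lfun g : 'Hom('rV[R]_m, R^o) := linfun (row_form g).

Lemma row_lfunE g x : row_lfun g x = \sum_l g l * x 0 l.
Proof. by rewrite lfunE. Qed.

Lemma row_lfun_coef (c : 'Hom('rV[R]_m, R^o)) :
  c = row_lfun (fun l => c (delta_mx 0 l)).
Proof.
apply/lfunP => x; rewrite row_lfunE [in LHS](row_sum_delta x) linear_sum /=.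
by apply: eq_bigr => l _; rewrite linearZ /= mulrC.
Qed.

End RowForm.

(** Among k distinct naturals one is at least k - 1; removing it reduces the bound to k - 1
    elements. The sum is doubled to avoid a division. *)
Lemma sum_uniq_nat_ge (s : seq nat) : uniq s ->
  (size s * (size s).+1 <= (\sum_(x <- s) x.+1).*2)%N.
Proof.
have [N] := ubnP (size s); elim: N s => // N IH s sN us.
case: (posnP (size s)) => [->//|s0].
have /hasP[x xs xP] : has (fun x => size s <= x.+1)%N s.
  apply: contraTT s0 => /hasPn h; rewrite -leqNgt.
  have : (size s <= size (iota 0 (size s).-1))%N.
    by apply: uniq_leq_size us _ => x /h; rewrite mem_iota; lia.
  by rewrite size_iota; lia.
rewrite (perm_big _ (perm_to_rem xs)) big_cons /=.
have := IH (rem x s); rewrite rem_uniq // size_rem //; move=> /(_ _ isT) h.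
have /h : ((size s).-1 < N)%N by lia.
rewrite -!muln2; move: xP s0; move: (\sum_(_ <- _) _)%N; case: (size s) => // k u.
by rewrite /= => h1 _ h2; nia.
Qed.

Lemma sum_ord_succ N : ((\sum_(i < N) i.+1).*2 = N * N.+1)%N.
Proof. by elim: N => [|N IH]; rewrite ?big_ord0 // big_ord_recr /= doubleD IH; lia. Qed.

Section HohlwegLange.

Variables (R : realType) (n : nat) (p : 'I_n.+3 -> 'rV[R]_2).

(** The vertices of the permutahedron, which is contained in every [AssI p]. They supply enough
    points on the two facets without any description of the vertices of the associahedron. *)
Definition perm_point (sg : {perm 'I_n.+1}) : 'rV[R]_n.+1 := \row_i (sg i).+1%:R.

(** An end of a diagonal is never strictly below it. Hence, when 0 is replaced by [d.1], the latter
    is not 0 itself, and likewise for the last vertex and [d.2]. *)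
Lemma HL_set_inner (d : 'I_n.+3 * 'I_n.+3) k : (d.1 < d.2)%N -> k \in HL_set p d ->
  (0 < k < n.+2)%N.
Proof.
case: d => i j /= ij; have i3 := ltn_ord i; have j3 := ltn_ord j; have k3 := ltn_ord k.
have k0 : k != ord0 -> (0 < k)%N by rewrite -val_eqE lt0n.
have kz : k != ord_max -> (k < n.+2)%N by rewrite -val_eqE /=; lia.
have [z1 z2] := orient_same (p i) (p j).
suff [h1 h2] : (k \in HL_set p (i, j) -> k != ord0) /\ (k \in HL_set p (i, j) -> k != ord_max).
  by move=> h; rewrite k0 ?h1 // kz ?h2.
have i_max : i != ord_max by rewrite -val_eqE /=; lia.
have j_0 : j != ord0 by rewrite -val_eqE /=; lia.
have below_i : i \notin below_set p (i, j) by rewrite inE z1 ltxx.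
have below_j : j \notin below_set p (i, j) by rewrite inE z2 ltxx.
pose B1 := replace_in ord0 i (below_set p (i, j)).
have B1_0 : ord0 \notin B1.
  rewrite /B1 /replace_in; case: ifP => [h|-> //]; rewrite in_setU1 in_setD1 eqxx orbF.
  by apply/eqP => E; move: below_i; rewrite -{1}E h.
have jB1 : j \notin B1.
  rewrite /B1 /replace_in; case: ifP => // _.
  by rewrite in_setU1 in_setD1 (negPf below_j) andbF orbF -val_eqE /= gtn_eqF.
rewrite /HL_set /= -/B1 /replace_in; case: ifP => h.
  split; rewrite in_setU1 in_setD1 => /orP[/eqP->//|/andP[h1 h2] //].
    by apply: contraTneq h2 => ->.
  by apply/eqP => E; rewrite E h in jB1.
split=> kB; first by apply: contraTneq kB => ->.
by apply: contraTneq kB => ->; rewrite h.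
Qed.

Lemma perm_point_AssI sg : AssI p (perm_point sg).
Proof.
have R2 : (2 : R) != 0 by rewrite pnatr_eq0.
have sumE (P : pred 'I_n.+1) : \sum_(i < n.+1 | P i) perm_point sg 0 i
    = (\sum_(i < n.+1 | P i) (sg i).+1)%N%:R.
  by rewrite natr_sum; apply: eq_bigr => i _; rewrite mxE.
split.
  rewrite sumE -sum_ord_succ -muln2 natrM mulfK //; congr (_%:R).
  by rewrite [RHS](reindex_inj (@perm_inj _ sg)).
move=> d /andP[dd _].
set S := HL_set p d; rewrite sumE.
pose A := [set i : 'I_n.+1 | inord i.+1 \in S]%SET.
(* Labels run from 1 to n + 1 and coordinates from 0 to n; the shift between them is a bijection
   because [S] avoids the two extreme vertices. *)
have cA : #|S| = #|A|.
  rewrite -(card_in_imset (f := fun i : 'I_n.+1 => inord i.+1 : 'I_n.+3) (D := A)).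
    apply: eq_card => k; apply/idP/imsetP => [kS|[i]]; last by rewrite inE => ? ->.
    have /andP[k0 kn] := HL_set_inner dd kS.
    have k1 : (k.-1 < n.+1)%N by lia.
    exists (Ordinal k1); first by rewrite inE /= prednK // inord_val.
    by rewrite /= prednK // inord_val.
  move=> i j _ _ /(congr1 val) /=; rewrite !inordK; first by move=> [/val_inj].
    by have := ltn_ord j; lia.
  by have := ltn_ord i; lia.
rewrite cA ler_pdivrMr ?ltr0n // -natrM muln2 ler_nat.
have := @sum_uniq_nat_ge [seq val (sg i) | i <- enum A].
rewrite size_map -cardE big_map big_enum /= => h.
apply: leq_trans (h _) _.
  rewrite map_inj_uniq ?enum_uniq // => i j /val_inj; exact: perm_inj.
rewrite leq_double; apply: eq_leq.
by rewrite (eq_bigl (fun i : 'I_n.+1 => inord i.+1 \in S)) // => i; rewrite inE.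
Qed.

Section Facets.

Hypothesis n2 : (2 <= n)%N.

Definition first_coord : 'Hom('rV[R]_n.+1, R^o) :=
  row_lfun (fun i : 'I_n.+1 => (i == ord0)%:R).

Lemma first_coordE x : first_coord x = x 0 ord0.
Proof.
rewrite row_lfunE (bigD1 ord0) //= mul1r big1 ?addr0 // => i /negPf ->.
by rewrite mul0r.
Qed.

(** Exchanging two coordinates other than the first keeps a permutation point on the facet, so a
    form normal to the facet has equal coefficients there. Since the sum of all coordinates is
    constant, it is a multiple of [first_coord] modulo lineality, and the point of [s1], off the
    facet, fixes the sign. *)
Lemma AssI_ray (a : R) (s0 s1 : {perm 'I_n.+1}) : a != 0 ->
  (forall x, AssI p x -> a * x 0 ord0 <= a * perm_point s0 0 ord0) ->
  a * perm_point s1 0 ord0 < a * perm_point s0 0 ord0 ->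
  ray_form (AssI p) (a *: first_coord).
Proof.
move=> a0 hmax hlt.
have cE x : (a *: first_coord) x = a * x 0 ord0 by rewrite scale_lfunE first_coordE.
have ptE (sg : {perm 'I_n.+1}) i : perm_point sg 0 i = (sg i).+1%:R by rewrite mxE.
have maxP (sg : {perm 'I_n.+1}) : sg ord0 = s0 ord0 -> max_face (AssI p) (a *: first_coord) (perm_point sg).
  move=> sE; split; first exact: perm_point_AssI.
  by move=> y Py; rewrite !cE (ptE sg) sE -ptE hmax.
have mf : max_face (AssI p) (a *: first_coord) !=set0 by exists (perm_point s0); apply: maxP.
have LP := linealityP _ (max_face_is_face mf).
split => //.
  move/LP => /(_ _ _ (perm_point_AssI s1) (perm_point_AssI s0)).
  by rewrite !cE => E; rewrite E ltxx in hlt.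
move=> d dN; pose g i := d (delta_mx 0 i) : R.
have dE x : d x = \sum_i g i * x 0 i by rewrite {1}[d]row_lfun_coef row_lfunE.
have gE j k : j != ord0 -> k != ord0 -> g j = g k.
  move=> j0 k0; case: (eqVneq j k) => [->//|jk].
  have jk0 : (tperm j k * s0)%g ord0 = s0 ord0 by rewrite permM tpermD.
  have : d (perm_point (tperm j k * s0)%g) = d (perm_point s0).
    apply/eqP; rewrite eq_le; apply/andP; split.
      exact: (dN _ (maxP s0 erefl)).2 _ (perm_point_AssI _).
    exact: (dN _ (maxP _ jk0)).2 _ (perm_point_AssI _).
  have kj : k != j by rewrite eq_sym.
  rewrite !dE (bigD1 j) //= (bigD1 k) //= [RHS](bigD1 j) //= [X in _ = _ + X](bigD1 k) //=.
  rewrite !mxE !permM tpermL tpermR.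
  set rest := \sum_(i | _) _; have -> : \sum_(i < n.+1 | (i != j) && (i != k))
      g i * perm_point s0 0 i = rest.
    apply: eq_bigr => i /andP[ij ik]; rewrite !mxE permM tpermD // eq_sym //.
  rewrite !addrA => /addIr E.
  have : (g j - g k) * ((s0 k).+1%:R - (s0 j).+1%:R) = 0 by move: E; lra.
  move/eqP; rewrite mulf_eq0 !subr_eq0 => /orP[/eqP->//|].
  by rewrite eqr_nat eqSS val_eqE (inj_eq perm_inj) (negPf kj).
have z0 : (ord_max : 'I_n.+1) != ord0 by rewrite -val_eqE /= -lt0n; lia.
pose u := g ord0 - g ord_max.
have dE' x : d x = g ord_max * (\sum_i x 0 i) + u * x 0 ord0.
  rewrite dE (bigD1 ord0) //= [in RHS](bigD1 ord0) //= mulrDr mulr_sumr /u.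
  under eq_bigr => i i0 do rewrite (gE _ _ i0 z0).
  by ring.
have sumP x y : AssI p x -> AssI p y -> \sum_i x 0 i = \sum_i y 0 i :> R.
  by move=> [-> _] [-> _].
exists (u / a).
  have := (dN _ (maxP s0 erefl)).2 _ (perm_point_AssI s1); rewrite !dE'.
  rewrite (sumP _ _ (perm_point_AssI s1) (perm_point_AssI s0)) lerD2l => h.
  rewrite -(pmulr_lge0 _ (_ : 0 < a * perm_point s0 0 ord0 - a * perm_point s1 0 ord0)); last first.
    by rewrite subr_gt0.
  by rewrite -mulrBr mulrA divfK // mulrBr subr_ge0.
apply/LP => x y Px Py; rewrite !add_lfunE !opp_lfunE !scale_lfunE !first_coordE !dE'.
by rewrite (sumP _ _ Px Py) /GRing.scale /= !mulrA divfK // !addrK.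
Qed.

End Facets.

End HohlwegLange.

Section HohlwegLangeFacets.

Variables (R : realType) (n : nat) (p : 'I_n.+3 -> 'rV[R]_2).
Hypothesis n2 : (2 <= n)%N.

Lemma orient_descending_gt0 (a b c : 'rV[R]_2) :
  abscissa a < abscissa b -> abscissa b < abscissa c ->
  ordinate b < ordinate a -> ordinate b <= ordinate c -> 0 < orient a b c.
Proof.
move=> ab bc ba cb; rewrite /orient.
have h1 : 0 <= (abscissa b - abscissa a) * (ordinate c - ordinate b).
  by rewrite mulr_ge0 // subr_ge0 // ltW.
have h2 : 0 < (ordinate a - ordinate b) * (abscissa c - abscissa b).
  by rewrite mulr_gt0 // subr_gt0.
by nra.
Qed.

Let one : 'I_n.+3 := inord 1.

Lemma val_one : one = 1%N :> nat. Proof. by rewrite inordK. Qed.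

(** The extended signs put the vertices 0 and n + 2 above the horizontal line and 1 below it. A
    vertex at least as high as 1 gives a left turn at 1. A lower one on the wrong side would enclose
    the vertex 1 in a triangle with 0 and n + 2. *)
Lemma signed_polygon_lower_edge (sigma : n.-1.-tuple bool) : signed_polygon sigma p ->
  forall k, k != ord0 -> k != one -> 0 < orient (p ord0) (p one) (p k).
Proof.
move=> [hp absc [h hh]].
have nth_max : nth true (extended_signs sigma) n.+2 = true.
  have -> : n.+2 = (size [:: true, false & sigma]).+1 by rewrite /= size_tuple; lia.
  by rewrite /extended_signs nth_cat ltnNge leqnSn /= subSnn.
have y0 : h < ordinate (p ord0) by have := hh ord0.
have y1 : ordinate (p one) < h by have := hh one; rewrite val_one.
have yz : h < ordinate (p ord_max) by have := hh ord_max; rewrite nth_max.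
have x01 : abscissa (p ord0) < abscissa (p one) by apply: absc; rewrite val_one.
have one_lt k : k != ord0 -> k != one -> (one < k)%N.
  by rewrite -!val_eqE /= val_one; lia.
have edge k : k != ord0 -> k != one -> ordinate (p one) <= ordinate (p k) ->
    0 < orient (p ord0) (p one) (p k).
  move=> k0 k1 yk; apply: orient_descending_gt0 => //; last by lra.
  exact: absc (one_lt _ k0 k1).
move=> k k0 k1; have [yk|yk] := lerP (ordinate (p one)) (ordinate (p k)); first exact: edge.
have z0 : (ord_max : 'I_n.+3) != ord0 by [].
have z1 : ord_max != one by rewrite -val_eqE /= val_one; lia.
have kz : k != ord_max by apply: contraTneq yk => ->; rewrite -leNgt; lra.
have xk : abscissa (p one) < abscissa (p k) by exact: absc (one_lt _ k0 k1).
have xz : abscissa (p k) < abscissa (p ord_max).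
  by apply: absc; rewrite ltn_neqAle -ltnS ltn_ord andbT.
have one0 : one != ord0 by rewrite -val_eqE /= val_one.
rewrite (orient_gt0_lt0 hp) 1?eq_sym //; apply/negP => neg.
apply: (@vertex_not_in_triangle _ _ _ hp one ord0 k ord_max); rewrite // 1?eq_sym //.
- by rewrite orient_swap_last oppr_ge0 ltW.
- rewrite /orient.
  have h1 : 0 <= (abscissa (p ord_max) - abscissa (p k)) * (ordinate (p one) - ordinate (p k)).
    by rewrite mulr_ge0 // subr_ge0 ltW.
  have h2 : 0 <= (ordinate (p ord_max) - ordinate (p k)) * (abscissa (p k) - abscissa (p one)).
    by rewrite mulr_ge0 // subr_ge0 ltW //; lra.
  by nra.
- by rewrite 2!orient_cycle ltW // edge //; lra.
- by apply: orient_descending_gt0 => //; lra.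
Qed.

(* The ears of the polygon at the vertices 1 and 0: they bound the first
   coordinate from below and from above. *)
Lemma signed_polygon_ears (sigma : n.-1.-tuple bool) : signed_polygon sigma p ->
  (exists2 d, Defs.diagonal p d & HL_set p d = [set one]%SET) /\
  (exists2 d, Defs.diagonal p d &
     HL_set p d = [set k : 'I_n.+3 | (1 < k < n.+2)%N]%SET).
Proof.
move=> hsig; have lower := signed_polygon_lower_edge hsig; have [hp _ _] := hsig.
have [s [hs s0]] := exists_ccw_sorted hp one.
have pos1 : position s one = 0%N by rewrite -(s0 ord0) // position_perm.
have one0 : one != ord0 by rewrite -val_eqE /= val_one.
have pos0 : position s ord0 = n.+2.
  apply/eqP; rewrite eqn_leq -ltnS position_lt leqNgt; apply/negP => lt.
  have [k kE] := position_surj s (ltnSn n.+2).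
  have k0 : k != ord0 by rewrite -(inj_eq (@position_inj _ s)) kE; lia.
  have k1 : k != one by rewrite -(inj_eq (@position_inj _ s)) kE pos1.
  have := lower k k0 k1; rewrite (orient_cyclic hs) 1?eq_sym // pos1 kE /cyclic3; lia.
(* The vertex after 1 and the vertex before 0: the diagonal from 0 to [v] cuts off the vertex 1, the
   one from 1 to [u] cuts off the vertex 0. *)
have [v vE] := @position_surj _ s 1 isT.
have [u uE] := @position_surj _ s n.+1 (ltnW (ltnSn _)).
have neq (i j : 'I_n.+3) : position s i != position s j -> i != j.
  by rewrite (inj_eq (@position_inj _ s)).
have v0 : v != ord0 by apply: neq; rewrite vE pos0.
have v1 : v != one by apply: neq; rewrite vE pos1.
have u0 : u != ord0 by apply: neq; rewrite uE pos0; lia.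
have u1 : u != one by apply: neq; rewrite uE pos1.
have below (i j k : 'I_n.+3) : i != j -> (k \in below_set p (i, j)) =
    cyclic3 (position s j) (position s i) (position s k).
  move=> ij; rewrite inE /=; have [z1 z2] := orient_same (p i) (p j).
  case: (eqVneq k i) => [->|ki]; first by rewrite z1 ltxx /cyclic3; lia.
  case: (eqVneq k j) => [->|kj]; first by rewrite z2 ltxx /cyclic3; lia.
  by rewrite (orient_cyclic_neg hs) // eq_sym.
have pos_eq (k i : 'I_n.+3) : (k == i) = (position s k == position s i).
  by rewrite (inj_eq (@position_inj _ s)).
have z0 : (ord_max : 'I_n.+3) != ord0 by [].
have z1 : (ord_max : 'I_n.+3) != one by rewrite -val_eqE /= val_one; lia.
split.
  exists (ord0, v).
    rewrite /Defs.diagonal /= adjacent_sym (adjacent_position hs) ?vE ?pos0 //.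
    by rewrite lt0n -[_ == _]/(v == ord0) v0 /=; lia.
  have -> : HL_set p (ord0, v) = below_set p (ord0, v).
    rewrite /HL_set /replace_in /= below 1?eq_sym // pos0 vE [cyclic3 _ _ _]/= ?andbF.
    rewrite (_ : cyclic3 1 n.+2 n.+2 = false); last by rewrite /cyclic3; lia.
    rewrite below 1?eq_sym // pos0 vE (_ : cyclic3 _ _ _ = false) //.
    have := position_lt s ord_max; move: z1; rewrite pos_eq pos1 /cyclic3; lia.
  apply/setP => k; rewrite below 1?eq_sym // inE pos_eq pos0 vE pos1.
  by have := position_lt s k; rewrite /cyclic3; lia.
have belowu k : (k \in below_set p (one, u)) = [&& k != ord0, k != one & k != u].
  rewrite below 1?eq_sym // !pos_eq pos0 pos1 uE.
  by have := position_lt s k; rewrite /cyclic3; lia.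
have u_gt : (1 < u)%N by move: u0 u1; rewrite -!val_eqE /= val_one; lia.
exists (one, u).
  rewrite /Defs.diagonal /= -/one val_one u_gt (adjacent_position hs) ?uE ?pos1 //=; lia.
apply/setP => k; rewrite inE /HL_set /replace_in belowu eqxx /= belowu z0 z1 /=.
have kk : (1 < k < n.+2)%N = [&& k != ord0, k != one & k != ord_max].
  by have := ltn_ord k; rewrite -!val_eqE /= val_one; lia.
(* Either the last vertex is [u], hence not below the diagonal, or it is below and gets replaced by
   [u]; both ways the set is the same. *)
rewrite kk; case: (eqVneq ord_max u) => [zu|uz] /=; first by rewrite zu belowu.
rewrite in_setU1 in_setD1 belowu; case: (eqVneq k u) => [->|ku] /=.
  by rewrite u0 u1 eq_sym uz.
by rewrite andbT; case: (k != ord_max); rewrite ?andbT ?andbF.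
Qed.

Lemma AssI_first_coord_bounds (sigma : n.-1.-tuple bool) : signed_polygon sigma p ->
  forall x, AssI p x -> 1 <= x 0 ord0 <= n.+1%:R.
Proof.
move=> hsig x [sx hx]; have [[d dd dS] [e ee eS]] := signed_polygon_ears hsig.
have hd := hx _ dd; have he := hx _ ee; rewrite dS in hd; rewrite eS in he.
have inE' (i : 'I_n.+1) : nat_of_ord (inord i.+1 : 'I_n.+3) = i.+1.
  by rewrite inordK //; have := ltn_ord i; lia.
have card_e : #|[set k : 'I_n.+3 | (1 < k < n.+2)%N]%SET| = n.
  have -> : [set k : 'I_n.+3 | (1 < k < n.+2)%N]%SET = ~: [set ord0; one; ord_max]%SET.
    apply/setP => k; rewrite !inE -!val_eqE /= val_one; have := ltn_ord k; lia.
  rewrite cardsCs finset.setCK card_ord finset.setUC cardsU1 cards2 !inE -!val_eqE /= val_one; lia.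
have sum1 : \sum_(i < n.+1 | inord i.+1 \in [set one]%SET) x 0 i = x 0 ord0.
  by apply: big_pred1 => i; rewrite finset.in_set1 -!val_eqE /= val_one inE'.
have sum2 : \sum_(i < n.+1 | inord i.+1 \in [set k : 'I_n.+3 | (1 < k < n.+2)%N]%SET) x 0 i
    = \sum_(i < n.+1 | i != ord0) x 0 i.
  apply: eq_bigl => i; rewrite inE inE' -val_eqE /=; have := ltn_ord i; lia.
rewrite (bigD1 ord0) //= in sx.
move: hd he sx; rewrite sum1 sum2 cards1 card_e => h1 h2 h3.
have R2 : (2 : R) != 0 by rewrite pnatr_eq0.
apply/andP; split; first by move: h1; rewrite mul1n divff.
(* The other n coordinates sum to at least n(n + 1)/2; subtracting from the fixed total leaves at
   most n + 1 for the first. *)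
have E : (n.+1 * n.+2)%N%:R / 2 = (n * n.+1)%N%:R / 2 + n.+1%:R :> R.
  have -> : (n.+1 * n.+2 = n * n.+1 + n.+1 * 2)%N by lia.
  by rewrite natrD mulrDl (natrM _ n.+1) mulfK.
by move: h2 h3; rewrite E; lra.
Qed.

Lemma AssI_opposite_rays (sigma : n.-1.-tuple bool) : signed_polygon sigma p ->
  opposite_rays (AssI p).
Proof.
move=> hsig; have bounds := AssI_first_coord_bounds hsig.
(* The reversal and the identity attain the extreme values n + 1 and 1 of the first coordinate. *)
pose rv : {perm 'I_n.+1} := perm rev_ord_inj.
have r0 : perm_point R rv 0 ord0 = n.+1%:R by rewrite mxE permE /= subn1.
have i0 : perm_point R 1%g 0 (ord0 : 'I_n.+1) = 1 by rewrite mxE perm1.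
have lt1 : (1 : R) < n.+1%:R by rewrite ltr1n; lia.
exists (first_coord R n); split.
  rewrite -[first_coord _ _]scale1r; apply: (@AssI_ray _ _ _ n2 1 rv 1%g).
  - by rewrite oner_eq0.
  - by move=> x /bounds /andP[_]; rewrite r0 !mul1r.
  - by rewrite r0 i0 !mul1r.
rewrite -scaleN1r; apply: (@AssI_ray _ _ _ n2 (-1) 1%g rv).
- by rewrite oppr_eq0 oner_eq0.
- by move=> x /bounds /andP[+ _]; rewrite i0 !mulN1r lerN2.
- by rewrite r0 i0 !mulN1r ltrN2.
Qed.

End HohlwegLangeFacets.

(** * Sums over the triangles of a triangulation *)

Section TripleSums.

Variables (R : realType) (m : nat).

Lemma sum_triple (F : 'I_m -> 'I_m -> 'I_m -> R) :
  \sum_(t : 'I_m * 'I_m * 'I_m) F t.1.1 t.1.2 t.2 = \sum_i \sum_j \sum_k F i j k.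
Proof.
rewrite -(pair_bigA _ (fun (x : 'I_m * 'I_m) k => F x.1 x.2 k)) /=.
by rewrite -(pair_bigA _ (fun i j => \sum_k F i j k)).
Qed.

Lemma sum_increasing_triples (F : 'I_m -> 'I_m -> 'I_m -> R) :
  (forall i j k, F i j k = F j i k) -> (forall i j k, F i j k = F i k j) ->
  \sum_i \sum_j \sum_k (if [&& i != j, j != k & i != k] then F i j k else 0) =
  (\sum_(i < m) \sum_(j < m) \sum_(k < m) (if (i < j < k)%N then F i j k else 0)) *+ 6.
Proof.
move=> F12 F23; pose T (i j k : 'I_m) := if (i < j < k)%N then F i j k else 0.
have -> : \sum_i \sum_j \sum_k (if [&& i != j, j != k & i != k] then F i j k else 0)
    = \sum_i \sum_j \sum_k (T i j k + T i k j + T j i k + T j k i + T k i j + T k j i).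
  apply: eq_bigr => i _; apply: eq_bigr => j _; apply: eq_bigr => k _.
  have e1 : F i k j = F i j k by [].
  have e2 : F j i k = F i j k by [].
  have e3 : F j k i = F i j k by rewrite F23.
  have e4 : F k i j = F i j k by rewrite F12.
  have e5 : F k j i = F i j k by rewrite F23 e4.
  rewrite /T e1 e2 e3 e4 e5 -!val_eqE /=.
  by case: (ltngtP i j) => ij; case: (ltngtP j k) => jk; case: (ltngtP i k) => ik /=;
    rewrite ?addr0 ?add0r //; lia.
have S23 (G : 'I_m -> 'I_m -> 'I_m -> R) :
  \sum_i \sum_j \sum_k G i k j = \sum_i \sum_j \sum_k G i j k.
  by apply: eq_bigr => i _; rewrite exchange_big.
have S12 (G : 'I_m -> 'I_m -> 'I_m -> R) :
  \sum_i \sum_j \sum_k G j i k = \sum_i \sum_j \sum_k G i j k.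
  by rewrite exchange_big.
under eq_bigr => i _ do (under eq_bigr => j _ do rewrite !big_split /=; rewrite !big_split /=).
rewrite !big_split /=.
rewrite (S23 T) (S12 T) (S23 (fun i j k => T j i k)) (S12 T).
rewrite (S12 (fun i j k => T i k j)) (S23 T).
rewrite (S12 (fun i j k => T k i j)) (S23 (fun i j k => T j i k)) (S12 T).
by rewrite !mulrS mulr0n addr0 !addrA.
Qed.

(** [gkz_vector] lists triangles by increasing labels, while geometry needs increasing positions.
    For a symmetric summand both sums are a sixth of the sum over all distinct triples, which is
    invariant under relabelling. *)
Lemma sum_increasing_triples_perm (s : {perm 'I_m}) (F : 'I_m -> 'I_m -> 'I_m -> R) :
  (forall i j k, F i j k = F j i k) -> (forall i j k, F i j k = F i k j) ->
  \sum_(i < m) \sum_(j < m) \sum_(k < m) (if (i < j < k)%N then F i j k else 0) =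
  \sum_(i < m) \sum_(j < m) \sum_(k < m) (if (i < j < k)%N then F (s i) (s j) (s k) else 0).
Proof.
move=> F12 F23; have six : (6%:R : R) != 0 by rewrite pnatr_eq0.
apply: (mulIf six); rewrite !mulr_natr -!sum_increasing_triples //.
rewrite (reindex_inj (@perm_inj _ s)) /=; apply: eq_bigr => i _.
rewrite (reindex_inj (@perm_inj _ s)) /=; apply: eq_bigr => j _.
rewrite (reindex_inj (@perm_inj _ s)) /=; apply: eq_bigr => k _.
by rewrite !(inj_eq (@perm_inj _ s)).
Qed.

End TripleSums.

Section Telescope.

Variables (R : realType) (n : nat) (S : seq (nat * nat)).
Hypothesis uS : uniq S.
Hypothesis nS : noncrossing S.
Hypothesis chS : forall d, d \in S -> (d.1.+1 < d.2 < n.+3)%N /\ d <> (0, n.+2)%N.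
Hypothesis szS : size S = n.

Let E := chord_or_side n S.

Definition inner_triangles x y (t : 'I_n.+3 * 'I_n.+3 * 'I_n.+3) :=
  [&& (x <= t.1.1)%N, (t.1.1 < t.1.2 < t.2)%N, (t.2 <= y)%N,
      E t.1.1 t.1.2, E t.1.2 t.2 & E t.1.1 t.2].

(** Each inner edge is the long side of one triangle and a short side of another, so its terms
    cancel. The induction removes the triangle on [(x, y)] and treats its two short sides
    separately. *)
Lemma triangle_sum_telescope (G : nat -> nat -> nat -> R) (phi : nat -> nat -> R) :
  (forall a b c, (a < b < c)%N -> (c < n.+3)%N ->
     G a b c = phi a b + phi b c - phi a c) ->
  forall x y, (x < y < n.+3)%N -> E x y ->
  \sum_(t | inner_triangles x y t) G t.1.1 t.1.2 t.2 =
  \sum_(x <= i < y) phi i i.+1 - phi x y.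
Proof.
move=> Gphi x y; have [N] := ubnP (y - x); elim: N x y => // N IH x y yN xyn Exy.
case: (eqVneq y x.+1) => [->|yx].
  rewrite big_nat1 subrr big_pred0 // => -[[a b] c].
  by rewrite /inner_triangles /=; lia.
have [|k [xky Exk Eky]] := inner_triangle uS nS chS szS _ Exy; first by lia.
have NC := chord_or_side_noncross uS nS chS szS.
have vx : (inord x : 'I_n.+3) = x :> nat by rewrite inordK //; lia.
have vk : (inord k : 'I_n.+3) = k :> nat by rewrite inordK //; lia.
have vy : (inord y : 'I_n.+3) = y :> nat by rewrite inordK //; lia.
pose t0 : 'I_n.+3 * 'I_n.+3 * 'I_n.+3 := (inord x, inord k, inord y).
rewrite (bigD1 t0) /=; last by rewrite /inner_triangles /= vx vk vy /E Exk Eky (Exy : chord_or_side n S x y); lia.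
rewrite (bigID (fun t : 'I_n.+3 * 'I_n.+3 * 'I_n.+3 => t.2 <= k)%N) /=.
rewrite (eq_bigl (inner_triangles x k)); last first.
  move=> [[a b] c]; rewrite /inner_triangles /= /t0 !xpair_eqE -!val_eqE /= vx vk vy.
  case: (E a b); case: (E b c); case: (E a c); rewrite ?andbF //=; lia.
rewrite [X in _ + (_ + X)](eq_bigl (inner_triangles k y)); last first.
  move=> [[a b] c]; rewrite /inner_triangles /= /t0 !xpair_eqE -!val_eqE /= vx vk vy.
  have cn := ltn_ord c; case: (boolP (E a b)) => Eab; rewrite ?andbF //=.
  case: (boolP (E b c)) => Ebc; rewrite ?andbF //=.
  case: (boolP (E a c)) => Eac; rewrite ?andbF //= !andbT.
  apply/idP/idP => [h|]; last by lia.
  (* A triangle other than [t0] with vertices strictly on both sides of [k] would have a side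
     crossing [(x, k)] or [(k, y)]. *)
  apply/negPn/negP => h'; have ak : (a < k)%N by lia.
  case: (eqVneq (a : nat) x) => [ax|ax]; case: (eqVneq (c : nat) y) => [cy|cy].
  - rewrite ax in Eab; rewrite cy in Ebc.
    by have := NC _ _ _ _ Exk Ebc; have := NC _ _ _ _ Eab Eky; lia.
  - by have := NC _ _ _ _ Eac Eky; lia.
  - by rewrite cy in Eac; have := NC _ _ _ _ Exk Eac; lia.
  - by have := NC _ _ _ _ Eac Eky; lia.
rewrite !IH //; try lia.
rewrite vx vk vy Gphi; [|lia|lia].
rewrite (@big_cat_nat _ _ _ k x y) /=; [|lia|lia].
by ring.
Qed.

(** The triangle lying under the crossing chord [d] itself is a witness. *)
Lemma inner_triangles_crossing j d : d \in S ->
  interleaved (0, j)%N d || interleaved d (0, j)%N ->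
  exists t, [/\ inner_triangles 0 n.+2 t, (0 < t.1.1 < j)%N & (j < t.2)%N].
Proof.
case: d => x y dS; rewrite /interleaved /= => xjy.
have [/= /andP[xy yn] _] := chS dS.
have Exy : E x y by rewrite /E /chord_or_side dS.
have [|k [xky Exk Eky]] := inner_triangle uS nS chS szS _ Exy; first by rewrite xy.
have vx : (inord x : 'I_n.+3) = x :> nat by rewrite inordK //; clear -xy yn; lia.
have vk : (inord k : 'I_n.+3) = k :> nat by rewrite inordK //; clear -xky yn; lia.
have vy : (inord y : 'I_n.+3) = y :> nat by rewrite inordK.
exists (inord x, inord k, inord y) => /=; rewrite /inner_triangles /= vx vk vy.
rewrite /E in Exy *; rewrite Exy Exk Eky; clear -xky xjy yn; split; lia.
Qed.

End Telescope.

(** * Heights as linear forms on the secondary polytope *)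

Section SecondaryPolytopeHeights.

Variables (R : realType) (n : nat) (q : 'I_n.+3 -> 'rV[R]_2).
Hypothesis hq : convex_polygon q.

Implicit Types (i j k l o : 'I_n.+3) (c : 'I_n.+3 -> R).
Implicit Types (d e : 'I_n.+3 * 'I_n.+3) (T : {set 'I_n.+3 * 'I_n.+3}).

(** Up to a factor 3, this is the integral over the polygon of the piecewise linear interpolation of
    [c] along [T]. *)
Lemma row_lfun_gkz T c : triangulation q T ->
  row_lfun c (gkz_vector q T) =
  \sum_(i < n.+3) \sum_(j < n.+3) \sum_(k < n.+3) (if (i < j < k)%N then
    if [&& edge q T i j, edge q T j k & edge q T i k] then
      area (q i) (q j) (q k) * (c i + c j + c k) else 0 else 0).
Proof.
move=> hT; rewrite row_lfunE.
have sideE i j : (i < j)%N -> adjacent q i j || ((i, j) \in T) = edge q T i j.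
  move=> ij; rewrite /edge; case: (boolP ((j, i) \in T)) => [/(triangulation_lt hT)|_].
    by rewrite /= ltnNge ltnW.
  by rewrite orbF.
under eq_bigr => l _ do rewrite mxE mulr_sumr.
rewrite (exchange_big_dep (triangle_of q T)) /=; last by move=> l t _ /andP[].
rewrite big_mkcond -sum_triple; apply: eq_bigr => -[[i j] k] _ /=.
case: (boolP (i < j < k)%N) => [/andP[ij jk]|nijk]; last first.
  case: ifP => // /and3P[/andP[ij _] /andP[jk _] _].
  by rewrite ij jk in nijk.
have ik := ltn_trans ij jk.
rewrite ij jk ik !sideE //=.
case: (boolP [&& edge q T i j, edge q T j k & edge q T i k]) => /= _ //.
transitivity (\sum_(l <- [:: i; j; k]) c l * area (q i) (q j) (q k)).
  rewrite big_uniq //=; last by rewrite !inE negb_or -!val_eqE /= (ltn_eqF ij) (ltn_eqF jk) (ltn_eqF ik).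
by rewrite !big_cons big_nil addr0 -!mulrDl addrA mulrC.
Qed.

Section Sorted.

Variables (s : {perm 'I_n.+3}) (T : {set 'I_n.+3 * 'I_n.+3}).
Hypothesis hs : ccw_sorted q s.
Hypothesis hT : triangulation q T.

Let S := chord_positions s T.

Lemma edge_perm (a b : 'I_n.+3) : (a < b)%N -> edge q T (s a) (s b) = chord_or_side n S a b.
Proof. by move=> ab; rewrite (edge_position hs hT) !position_perm. Qed.

Lemma row_lfun_gkz_sorted c :
  2 * row_lfun c (gkz_vector q T) =
  \sum_(t | inner_triangles S 0 n.+2 t)
     orient (q (s t.1.1)) (q (s t.1.2)) (q (s t.2)) * (c (s t.1.1) + c (s t.1.2) + c (s t.2)).
Proof.
rewrite row_lfun_gkz // (sum_increasing_triples_perm s (F := fun i j k =>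
    if [&& edge q T i j, edge q T j k & edge q T i k] then
      area (q i) (q j) (q k) * (c i + c j + c k) else 0)).
- rewrite -sum_triple mulr_sumr [RHS]big_mkcond; apply: eq_bigr => -[[a b] k] _ /=.
  rewrite /inner_triangles /= -[(k <= n.+2)%N]ltnS ltn_ord /=.
  case: (boolP (a < b < k)%N) => [/andP[ab bk]|_] /=; last by rewrite mulr0.
  have ak := ltn_trans ab bk.
  rewrite !edge_perm //; case: ifP => _; last by rewrite mulr0.
  rewrite /area gtr0_norm; last exact: hs.
  by field.
- move=> i j k; rewrite (edge_sym _ _ i j) [edge _ _ j k && _]andbC /area orient_swap normrN.
  by rewrite (addrC (c i)).
- move=> i j k; rewrite (edge_sym _ _ j k) andbC -!andbA [edge _ _ k j && _]andbC.
  rewrite /area orient_swap_last normrN addrAC.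
  by case: (edge q T i j); case: (edge q T i k); case: (edge q T k j).
Qed.

End Sorted.

(* What the edge contributions [orient o i j * (c i + c j + c o)] of the
   triangle [ijk] miss; it vanishes when [c] is affine on [o], [i], [j], [k]. *)
Definition excess c o i j k : R :=
  orient (q o) (q i) (q j) * (c k - c o) + orient (q o) (q j) (q k) * (c i - c o)
  - orient (q o) (q i) (q k) * (c j - c o).

(** Does not depend on a triangulation. Terms with an end at position 0 vanish, so it is twice the
    value of [c] at the triangulation whose diagonals all start at [s ord0]. *)
Definition boundary_sum c (s : {perm 'I_n.+3}) : R :=
  let phi (a b : nat) := orient (q (s ord0)) (q (s (inord a))) (q (s (inord b)))
     * (c (s (inord a)) + c (s (inord b)) + c (s ord0)) in
  \sum_(0 <= i < n.+2) phi i i.+1 - phi 0 n.+2.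

Lemma row_lfun_gkz_excess s T c : ccw_sorted q s -> triangulation q T ->
  2 * row_lfun c (gkz_vector q T) = boundary_sum c s +
  \sum_(t | inner_triangles (chord_positions s T) 0 n.+2 t)
    excess c (s ord0) (s t.1.1) (s t.1.2) (s t.2).
Proof.
move=> hs hT; rewrite (row_lfun_gkz_sorted hs hT).
pose lab (a : nat) := s (inord a).
pose G (a b k : nat) := orient (q (lab a)) (q (lab b)) (q (lab k)) * (c (lab a) + c (lab b) + c (lab k))
  - excess c (s ord0) (lab a) (lab b) (lab k).
have := @triangle_sum_telescope R n _ (uniq_chord_positions s hT)
  (noncrossing_chord_positions hq hs hT) (diagonal_chord_positions hs hT)
  (size_chord_positions s hT) G (fun a b => orient (q (s ord0)) (q (lab a)) (q (lab b))
     * (c (lab a) + c (lab b) + c (s ord0))).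
move=> /(_ _ 0 n.+2) H.
have -> : boundary_sum c s =
    \sum_(t : 'I_n.+3 * 'I_n.+3 * 'I_n.+3 | inner_triangles (chord_positions s T) 0 n.+2 t)
    G t.1.1 t.1.2 t.2.
  symmetry; apply: H; last by rewrite /chord_or_side !eqxx !orbT.
    by move=> a b k _ _; rewrite /G /excess /orient; ring.
  by rewrite ltnSn.
rewrite -big_split /=; apply: eq_bigr => -[[a b] k] _ /=.
by rewrite /G /lab !inord_val subrK.
Qed.

Definition affine_height (u v w : R) i : R := u + v * abscissa (q i) + w * ordinate (q i).

Lemma gkz_affine_height u v w : exists m, forall T, triangulation q T ->
  row_lfun (affine_height u v w) (gkz_vector q T) = m.
Proof.
have [s [hs _]] := exists_ccw_sorted hq ord0.
exists (boundary_sum (affine_height u v w) s / 2) => T hT.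
have := row_lfun_gkz_excess (affine_height u v w) hs hT; rewrite big1 ?addr0 => [<-|t _].
  by rewrite mulrC mulKf // pnatr_eq0.
by rewrite /excess /affine_height /orient; ring.
Qed.

Definition fold_height d i : R := `|orient (q d.1) (q d.2) (q i)|.

(** On either side of [d] the fold is linear up to sign, so a triangle on one side has no excess.
    For a triangle straddling [d], subtracting the vanishing excess of the linear form leaves twice
    a single product of nonnegative factors, which is zero only if the triangle has its first vertex
    at [d.1]. *)
Lemma fold_height_excess s d (a b k : 'I_n.+3) : ccw_sorted q s -> s ord0 = d.1 ->
  d.1 != d.2 -> (a < b < k)%N ->
  let j := position s d.2 in let x := excess (fold_height d) (s ord0) (s a) (s b) (s k) in
  [/\ 0 <= x, (a == 0 :> nat) || (k <= j)%N || (j <= a)%N -> x = 0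
    & (0 < a < j)%N -> (j < k)%N -> 0 < x].
Proof.
move=> hs s0 d12 /andP[ab bk] j x; have ak := ltn_trans ab bk.
have d10 : position s d.1 = 0%N by rewrite -s0 position_perm.
have j0 : (0 < j)%N by rewrite lt0n -d10 (inj_eq (@position_inj _ s)) eq_sym.
pose l (i : 'I_n.+3) := orient (q d.1) (q d.2) (q (s i)).
have [z1 z2] := orient_same (q d.1) (q d.2).
have l_neg (i : 'I_n.+3) : (i <= j)%N -> l i <= 0.
  move=> ij; rewrite /l; case: (eqVneq d.1 (s i)) => [<-|i1]; first by rewrite z1.
  case: (eqVneq d.2 (s i)) => [<-|i2]; first by rewrite z2.
  rewrite leNgt (orient_cyclic hs) // d10 -/j position_perm.
  move: i1; rewrite -s0 (inj_eq perm_inj) -val_eqE /= /cyclic3; lia.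
have l_pos (i : 'I_n.+3) : (j < i)%N -> 0 < l i.
  move=> ij; have i1 : d.1 != s i by rewrite -s0 (inj_eq perm_inj) -val_eqE /=; lia.
  have i2 : d.2 != s i by rewrite -(inj_eq (@position_inj _ s)) position_perm -/j; lia.
  by rewrite /l (orient_cyclic hs) // d10 -/j position_perm /cyclic3; lia.
have l_nneg (i : 'I_n.+3) : (j <= i)%N -> 0 <= l i.
  rewrite leq_eqVlt => /orP[/eqP ji|/l_pos/ltW//].
  by rewrite /l -(perm_position ji : d.2 = s i) z2.
pose br (i i' : 'I_n.+3) := orient (q (s ord0)) (q (s i)) (q (s i')).
have br_pos (i i' : 'I_n.+3) : (0 < i < i')%N -> 0 < br i i'.
  by move=> /andP[i0 ii]; exact: hs.
have br_nneg (i i' : 'I_n.+3) : (i < i')%N -> 0 <= br i i'.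
  case: (posnP i) => [i0|i0 ii]; last by rewrite ltW // br_pos // i0.
  have -> : i = ord0 by apply: val_inj.
  by move=> _; rewrite /br orient_diag.
have br0 (i : 'I_n.+3) : br ord0 i = 0.
  by rewrite /br orient_diag.
have id0 : br a b * l k + br b k * l a - br a k * l b = 0.
  by rewrite /br /l s0 /orient; ring.
have h0 : fold_height d (s ord0) = 0 by rewrite /fold_height s0 z1 normr0.
have xE : x = br a b * `|l k| + br b k * `|l a| - br a k * `|l b|.
  by rewrite /x /excess h0 !subr0.
have [kj|jk] := leqP k j.
  have x0 : x = 0.
    rewrite xE !ler0_norm ?l_neg //; try lia.
    by rewrite !mulrN -!opprD id0 oppr0.
  by rewrite x0; split => //; lia.
have [ja|aj] := leqP j a.
  have x0 : x = 0 by rewrite xE !ger0_norm ?l_nneg //; lia.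
  by rewrite x0; split => //; lia.
rewrite (gtr0_norm (l_pos _ jk)) (ler0_norm (l_neg _ (ltnW aj))) in xE.
have [bj|jb] := leqP b j.
  have x2 : x = 2 * (br a b * l k).
    by rewrite xE (ler0_norm (l_neg _ bj)); lra.
  rewrite x2; split.
  - by rewrite !mulr_ge0 ?br_nneg // ltW // l_pos.
  - move=> a0; have -> : a = ord0 by apply: val_inj => /=; move: a0 jk aj; lia.
    by rewrite br0 mul0r mulr0.
  - by move=> /andP[a0 _] _; rewrite !mulr_gt0 ?br_pos ?a0 // l_pos.
have x2 : x = 2 * (br b k * - l a).
  by rewrite xE (gtr0_norm (l_pos _ jb)); lra.
rewrite x2; split.
- by rewrite !mulr_ge0 ?br_nneg // oppr_ge0 l_neg // ltnW.
- move=> a0; have -> : a = ord0 by apply: val_inj => /=; move: a0 jk aj; lia.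
  by rewrite /l s0 z1 oppr0 !mulr0.
- move=> /andP[a0 _] _; rewrite !mulr_gt0 ?br_pos //; first by rewrite (leq_ltn_trans _ ab).
  rewrite oppr_gt0 /l (orient_cyclic_neg hs) //.
  + by rewrite d10 -/j position_perm /cyclic3; lia.
  + by rewrite eq_sym -(inj_eq (@position_inj _ s)) position_perm -/j; lia.
  + by rewrite -s0 (inj_eq perm_inj) -val_eqE /=; lia.
Qed.

(** With [d.1] as base vertex the minimum is half the boundary sum, reached when no excess is
    positive. A triangle with positive excess has a side crossing [d]; conversely, if [d] is not in
    [T], some diagonal of [T] crosses it and yields such a triangle. *)
Lemma gkz_fold_height d : Defs.diagonal q d -> exists m, forall T, triangulation q T ->
  [/\ m <= row_lfun (fold_height d) (gkz_vector q T),
      d \in T -> row_lfun (fold_height d) (gkz_vector q T) = m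
    & d \notin T -> m < row_lfun (fold_height d) (gkz_vector q T)].
Proof.
move=> hd; have d12 : (d.1 < d.2)%N by case/andP: hd.
have d1d2 : d.1 != d.2 by rewrite -val_eqE ltn_eqF.
have [s [hs s0]] := exists_ccw_sorted hq d.1; have {}s0 : s ord0 = d.1 by apply: s0.
set h := fold_height d.
exists (boundary_sum h s / 2) => T hT.
have sumE := row_lfun_gkz_excess h hs hT.
set X := \sum_(t | _) _ in sumE.
have vE : row_lfun h (gkz_vector q T) = boundary_sum h s / 2 + X / 2.
  rewrite -mulrDl -sumE.
  by rewrite [in RHS]mulrC mulKf // pnatr_eq0.
pose S := chord_positions s T.
pose j := position s d.2.
have exc (t : 'I_n.+3 * 'I_n.+3 * 'I_n.+3) : inner_triangles S 0 n.+2 t -> _ :=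
  fun ht => fold_height_excess hs s0 d1d2 (proj1 (andP (proj2 (andP ht)))).
have X0 : 0 <= X by apply: sumr_ge0 => t /exc[].
have d10 : position s d.1 = 0%N by rewrite -s0 position_perm.
have dE : chord_position s d = (0, j)%N.
  by rewrite /chord_position d10 min0n max0n.
rewrite vE; split.
- by rewrite lerDl divr_ge0.
- move=> dT; have -> : X = 0; last by rewrite mul0r addr0.
  rewrite /X; apply: big1 => t ht; have [_ + _] := exc _ ht; apply.
  apply: contraTT ht => h1; apply/negP => /and5P[_ _ _ _ /andP[_ Eac]].
  have dS : (0, j)%N \in S by rewrite -dE (chord_positionsP s hT).
  have := chord_or_side_noncrossing (uniq_chord_positions s hT)
    (noncrossing_chord_positions hq hs hT) (diagonal_chord_positions hs hT)
    (size_chord_positions s hT) Eac dS.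
  rewrite /interleaved /=; move: h1; rewrite -/j; lia.
- move=> dT; rewrite ltrDl divr_gt0 // lt_neqAle X0 andbT eq_sym.
  have [e [eT ce]] : exists e, e \in T /\ cross q d e.
    apply: contrapT => ne; move/negP: dT; apply; apply: triangulation_maximal => // e eT ce.
    by apply: ne; exists e.
  have e12 := triangulation_lt hT eT.
  move/(cross_position hq hs d12 e12): ce; rewrite dE => ce.
  have eS : chord_position s e \in S by rewrite (chord_positionsP s hT).
  have [t0 [ht0 h1 h2]] := inner_triangles_crossing (uniq_chord_positions s hT)
    (noncrossing_chord_positions hq hs hT) (diagonal_chord_positions hs hT)
    (size_chord_positions s hT) eS ce.
  have [_ _ pos] := exc _ ht0.
  rewrite /X (bigD1 t0) //= gt_eqF // ltr_pwDl //.
    exact: pos.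
  by apply: sumr_ge0 => t /andP[/exc[]].
Qed.

End SecondaryPolytopeHeights.

(** * Normal cones of the secondary polytope *)

Section SecondaryPolytope.

Variables (R : realType) (n : nat) (q : 'I_n.+3 -> 'rV[R]_2).
Hypothesis hq : convex_polygon q.

Implicit Types (i j k l : 'I_n.+3) (g : 'I_n.+3 -> R).
Implicit Types (d e : 'I_n.+3 * 'I_n.+3) (T : {set 'I_n.+3 * 'I_n.+3}).

Lemma GKZ_seq : exists2 s : seq 'rV[R]_n.+3, GKZ q = conv_hull [set` s]
  & forall x, x \in s -> exists2 T, triangulation q T & x = gkz_vector q T.
Proof.
pose s := [seq gkz_vector q T | T <- enum [pred T | `[< triangulation q T >]]].
have sP x : x \in s -> exists2 T, triangulation q T & x = gkz_vector q T.
  by move=> /mapP[T]; rewrite mem_enum => /asboolP hT ->; exists T.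
exists s => //; rewrite /GKZ; congr conv_hull; apply/seteqP; split=> [_ [T hT <-]|x] /=.
  by apply: map_f; rewrite mem_enum; apply/asboolP.
by move=> /sP[T hT ->]; exists T.
Qed.

Lemma gkz_vector_GKZ T : triangulation q T -> GKZ q (gkz_vector q T).
Proof. by move=> hT; apply: conv_hull_sub; exists T. Qed.

Lemma GKZ_ge g (m : R) : (forall T, triangulation q T -> m <= row_lfun g (gkz_vector q T)) ->
  forall x, GKZ q x -> m <= row_lfun g x.
Proof.
move=> hm x Px; suff : ((- row_lfun g) x : R) <= - m by rewrite opp_lfunE lerN2.
move: x Px; apply: conv_hull_le => _ [T hT <-].
by rewrite opp_lfunE lerN2 hm.
Qed.

Lemma GKZ_max_triangulation (c : 'Hom('rV[R]_n.+3, R^o)) : GKZ q !=set0 ->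
  exists2 T, triangulation q T & max_face (GKZ q) c (gkz_vector q T).
Proof.
move=> P0; have [s sE sT] := GKZ_seq; rewrite sE in P0 *.
have [a [/sT[T hT ->] ca]] := polytope_max_face c P0.
by exists T.
Qed.

(** Cramer's rule on three vertices, with their nonzero orientation as determinant. *)
Lemma affine_height_eq0 u v w : (forall i, affine_height q u v w i = 0) ->
  [/\ u = 0, v = 0 & w = 0].
Proof.
move=> h.
pose i1 : 'I_n.+3 := inord 1; pose i2 : 'I_n.+3 := inord 2.
have v1 : val i1 = 1%N by rewrite /= inordK.
have v2 : val i2 = 2%N by rewrite /= inordK.
have D : orient (q ord0) (q i1) (q i2) != 0.
  by apply: (vertices_not_collinear hq); rewrite -val_eqE ?v1 ?v2.
have h0 := h ord0; have h1 := h i1; have h2 := h i2.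
rewrite /affine_height in h0 h1 h2.
have v0 : v = 0.
  apply: (mulfI D); rewrite mulr0 /orient.
  set x0 := abscissa _ in h0 *; set y0 := ordinate _ in h0 *.
  set x1 := abscissa _ in h1 *; set y1 := ordinate _ in h1 *.
  set x2 := abscissa _ in h2 *; set y2 := ordinate _ in h2 *.
  have -> : ((x1 - x0) * (y2 - y0) - (y1 - y0) * (x2 - x0)) * v =
    (y2 - y0) * ((u + v * x1 + w * y1) - (u + v * x0 + w * y0))
    - (y1 - y0) * ((u + v * x2 + w * y2) - (u + v * x0 + w * y0)) by ring.
  by rewrite h0 h1 h2 !subrr !mulr0 subrr.
have w0 : w = 0.
  apply: (mulfI D); rewrite mulr0 /orient.
  set x0 := abscissa _ in h0 *; set y0 := ordinate _ in h0 *.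
  set x1 := abscissa _ in h1 *; set y1 := ordinate _ in h1 *.
  set x2 := abscissa _ in h2 *; set y2 := ordinate _ in h2 *.
  have -> : ((x1 - x0) * (y2 - y0) - (y1 - y0) * (x2 - x0)) * w =
    (x1 - x0) * ((u + v * x2 + w * y2) - (u + v * x0 + w * y0))
    - (x2 - x0) * ((u + v * x1 + w * y1) - (u + v * x0 + w * y0)) by ring.
  by rewrite h0 h1 h2 !subrr !mulr0 subrr.
by split => //; move: h0; rewrite v0 w0 !mul0r !addr0.
Qed.

Definition piecewise_height T (a : 'I_n.+3 * 'I_n.+3 -> R) u v w i : R :=
  \sum_(e in T) a e * fold_height q e i + affine_height q u v w i.

Lemma row_lfun_piecewise T a u v w x :
  row_lfun (piecewise_height T a u v w) x =
  \sum_(e in T) a e * row_lfun (fold_height q e) x + row_lfun (affine_height q u v w) x.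
Proof.
rewrite !row_lfunE /piecewise_height.
under eq_bigr => l _ do rewrite mulrDl mulr_suml.
rewrite big_split /= exchange_big /=; congr (_ + _).
apply: eq_bigr => e _; rewrite row_lfunE mulr_sumr.
by apply: eq_bigr => l _; rewrite mulrA.
Qed.

(** The diagonals kept by the flip still have minimal folds, so only the fold of [d] changes its
    value. As [r] does not depend on the coefficients, [a d] can be read off from the values at [T]
    and [T']. *)
Lemma piecewise_height_flip T d : triangulation q T -> d \in T ->
  exists T' (r : R), [/\ triangulation q T', 0 < r & forall a u v w,
    row_lfun (piecewise_height T a u v w) (gkz_vector q T') =
    row_lfun (piecewise_height T a u v w) (gkz_vector q T) + a d * r].
Proof.
move=> hT dT; have [d' [d'T _ hT' d'd _]] := triangulation_flip hq hT dT.
have [_ diT _] := hT.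
set T' := (d' |: T :\ d)%SET in hT'.
have dT' : d \notin T'.
  rewrite in_setU1 in_setD1 eqxx orbF; apply/eqP => E.
  by rewrite -E dT in d'T.
have [m hm] := gkz_fold_height hq (diT _ dT).
have [_ /(_ dT) md _] := hm _ hT; have [_ _ /(_ dT') md'] := hm _ hT'.
exists T', (row_lfun (fold_height q d) (gkz_vector q T') - m); split=> //.
  by rewrite subr_gt0.
move=> a u v w; rewrite !row_lfun_piecewise.
have [M hM] := gkz_affine_height hq u v w; rewrite !hM //.
rewrite (bigD1 d dT) [in RHS](bigD1 d dT) /= md.
rewrite [X in _ + X + M](eq_bigr (fun e => a e * row_lfun (fold_height q e) (gkz_vector q T))).
  by ring.
move=> e /andP[eT ed]; congr (_ * _).
have [me hme] := gkz_fold_height hq (diT _ eT).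
have eT' : e \in T' by rewrite in_setU1 in_setD1 ed; apply/orP; right.
by have [_ -> // _] := hme _ hT; have [_ -> // _] := hme _ hT'.
Qed.

(** A dimension count: 3 affine functions and n folds in a space of dimension n + 3. Independence
    suffices; flips kill the fold coefficients of a null combination, and three vertices kill the
    affine part. *)
Lemma heights_piecewise T g : triangulation q T ->
  exists a u v w, g = piecewise_height T a u v w.
Proof.
move=> hT; have [cT _ _] := hT.
pose A : 'M[R]_(3, n.+3) := \matrix_(i, j) nth 0 [:: 1; abscissa (q j); ordinate (q j)] i.
pose B : 'M[R]_(#|T|, n.+3) := \matrix_(i, j) fold_height q (enum_val i) j.
pose coef (x : 'rV[R]_#|T|) e := if [pick i : 'I_#|T| | enum_val i == e] is Some i then x 0 i else 0.
have coefE x (i : 'I_#|T|) : coef x (enum_val i) = x 0 i.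
  rewrite /coef; case: pickP => [k /eqP /enum_val_inj -> //|/(_ i)].
  by rewrite eqxx.
pose o0 : 'I_3 := ord0; pose o1 : 'I_3 := lift ord0 ord0.
pose o2 : 'I_3 := lift ord0 (lift ord0 ord0).
have o3 (i : 'I_3) : [\/ i = o0, i = o1 | i = o2].
  case: i => [[|[|[|//]]] hi]; [constructor 1 | constructor 2 | constructor 3];
    exact: val_inj.
have mulE (x : 'rV[R]_(3 + #|T|)) j : (x *m col_mx A B) 0 j =
    piecewise_height T (coef (rsubmx x)) (lsubmx x 0 o0) (lsubmx x 0 o1) (lsubmx x 0 o2) j.
  rewrite -{1}[x]hsubmxK mul_row_col mxE addrC /piecewise_height; congr (_ + _).
    rewrite mxE [RHS]big_enum_val; apply: eq_bigr => i _.
    by rewrite coefE [B _ _]mxE.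
  rewrite mxE !big_ord_recl big_ord0 ![A _ _]mxE /= addr0 mulr1 addrA.
  by [].
have fold0 (a : 'I_n.+3 * 'I_n.+3 -> R) u v w :
    (forall j, piecewise_height T a u v w j = 0) -> forall e, e \in T -> a e = 0.
  move=> h0 e eT; have [T' [r [hT' r0 /(_ a u v w)]]] := piecewise_height_flip hT eT.
  rewrite !row_lfunE !big1; [|by move=> l _; rewrite h0 mul0r..].
  by move/esym/eqP; rewrite add0r mulf_eq0 (gt_eqF r0) orbF => /eqP.
have free_M : row_free (col_mx A B).
  apply: inj_row_free => x x0.
  have h0 j : piecewise_height T (coef (rsubmx x)) (lsubmx x 0 o0) (lsubmx x 0 o1)
      (lsubmx x 0 o2) j = 0 by rewrite -mulE x0 mxE.
  have r0 (i : 'I_#|T|) : rsubmx x 0 i = 0 by rewrite -coefE; apply: fold0 h0 _ (enum_valP i).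
  have [|l0 l1 l2] := @affine_height_eq0 (lsubmx x 0 o0) (lsubmx x 0 o1) (lsubmx x 0 o2).
    move=> j; rewrite -[RHS](h0 j) /piecewise_height big1 ?add0r // => e eT.
    have -> : e = enum_val (enum_rank_in eT e) by rewrite enum_rankK_in.
    by rewrite coefE r0 mul0r.
  have rx : rsubmx x = 0 by apply/rowP => i; rewrite r0 mxE.
  have lx : lsubmx x = 0 by apply/rowP => i; rewrite [RHS]mxE; case: (o3 i) => ->.
  by rewrite -[LHS]hsubmxK lx rx row_mx0.
have full_M : row_full (col_mx A B).
  by rewrite /row_full (eqP free_M) cT.
have /submxP[x xE] := submx_full (\row_j g j) full_M.
exists (coef (rsubmx x)), (lsubmx x 0 o0), (lsubmx x 0 o1), (lsubmx x 0 o2).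
by apply/funext => j; rewrite -mulE -xE mxE.
Qed.

Lemma GKZ_affine_const u v w x y : GKZ q x -> GKZ q y ->
  row_lfun (affine_height q u v w) x = row_lfun (affine_height q u v w) y.
Proof.
have [m hm] := gkz_affine_height hq u v w.
have const z : GKZ q z -> row_lfun (affine_height q u v w) z = m.
  move=> Pz; apply/eqP; rewrite eq_le; apply/andP; split.
    by move: z Pz; apply: conv_hull_le => _ [T hT <-]; rewrite hm.
  by apply: GKZ_ge Pz => T hT; rewrite hm.
by move=> Px Py; rewrite !const.
Qed.

Lemma GKZ_const_affine g : GKZ q !=set0 ->
  (forall x y, GKZ q x -> GKZ q y -> row_lfun g x = row_lfun g y) ->
  exists u v w, g = affine_height q u v w.
Proof.
move=> P0 gc; have [T hT _] := GKZ_max_triangulation 0 P0.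
have [a [u [v [w gE]]]] := heights_piecewise g hT.
exists u, v, w; rewrite gE; apply/funext => i; rewrite /piecewise_height big1 ?add0r //.
move=> e eT; have [T' [r [hT' r0 /(_ a u v w)]]] := piecewise_height_flip hT eT.
rewrite -gE (gc _ _ (gkz_vector_GKZ hT') (gkz_vector_GKZ hT)) => /eqP.
rewrite addrC -subr_eq subrr eq_sym mulf_eq0 (gt_eqF r0) orbF => /eqP ->.
by rewrite mul0r.
Qed.

(* A maximal triangulation [T] writes [g] as a nonpositive combination of the
   fold heights of its diagonals; each diagonal with a nonzero coefficient is
   shared by all the maximal triangulations. *)
Lemma GKZ_normal_cone_fold g : GKZ q !=set0 ->
  ~ (exists u v w, g = affine_height q u v w) ->
  exists2 d, Defs.diagonal q d &
    normal_cone (GKZ q) (max_face (GKZ q) (row_lfun g)) (- row_lfun (fold_height q d)).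
Proof.
move=> P0 gN; have [T hT [PT maxT]] := GKZ_max_triangulation (row_lfun g) P0.
have [_ diT _] := hT.
have [a [u [v [w gE]]]] := heights_piecewise g hT.
have a_le0 e : e \in T -> a e <= 0.
  move=> eT; have [T' [r [hT' r0 /(_ a u v w)]]] := piecewise_height_flip hT eT.
  rewrite -gE => E; have := maxT _ (gkz_vector_GKZ hT'); rewrite E gerDl.
  by rewrite pmulr_lle0.
have [d dT ad] : exists2 d, d \in T & a d < 0.
  apply: contrapT => aN; apply: gN; exists u, v, w; rewrite gE; apply/funext => i.
  rewrite /piecewise_height big1 ?add0r // => e eT.
  suff -> : a e = 0 by rewrite mul0r.
  apply/eqP; rewrite eq_le a_le0 //= leNgt; apply/negP => ae; apply: aN.
  by exists e.
exists d; first exact: diT.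
have foldT e y : e \in T -> GKZ q y ->
    row_lfun (fold_height q e) (gkz_vector q T) <= row_lfun (fold_height q e) y.
  move=> eT; have [m hm] := gkz_fold_height hq (diT _ eT).
  have [_ -> // _] := hm _ hT; apply: GKZ_ge => T' hT'.
  by have [] := hm _ hT'.
move=> x [Px maxx]; split=> // y Py; rewrite !opp_lfunE lerN2.
apply: le_trans (foldT _ _ dT Py).
(* Every term of the combination is largest at [T], yet the total at [x] is no smaller than at [T].
   So the term of [d] cannot drop, and dividing by [a d < 0] bounds the fold at [x] by its
   minimum. *)
have := maxx _ PT; rewrite gE !row_lfun_piecewise (GKZ_affine_const _ _ _ Px PT) lerD2r.
rewrite (bigD1 d dT) [leRHS](bigD1 d dT) /= => h.
have h2 : \sum_(e in T | e != d) a e * row_lfun (fold_height q e) x <=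
    \sum_(e in T | e != d) a e * row_lfun (fold_height q e) (gkz_vector q T).
  by apply: ler_sum => e /andP[eT _]; apply: ler_wnM2l; [exact: a_le0 | exact: foldT].
have h3 : a d * row_lfun (fold_height q d) (gkz_vector q T) <=
    a d * row_lfun (fold_height q d) x by move: h h2; lra.
by rewrite ler_nM2l in h3.
Qed.

End SecondaryPolytope.

(** * Two folds never combine to an affine height *)

Section NoOppositeRays.

Variables (R : realType) (n : nat) (q : 'I_n.+3 -> 'rV[R]_2).
Hypothesis hq : convex_polygon q.
Hypothesis n2 : (2 <= n)%N.

Implicit Types (i j k l : 'I_n.+3) (d e : 'I_n.+3 * 'I_n.+3).

Let line d i : R := orient (q d.1) (q d.2) (q i).

Lemma line_ends d : line d d.1 = 0 /\ line d d.2 = 0.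
Proof. exact: orient_same. Qed.

(** By hypothesis the auxiliary [h] is affine on the vertices; it is nonnegative and vanishes at
    three noncollinear vertices, hence everywhere. As [al] is positive, the form of [d] keeps the
    sign [eps] on all vertices, so the line of [d] supports the polygon, which is absurd for a
    diagonal. *)
Lemma fold_heights_region d d' (al be eps eps' u v w : R) i j k :
  Defs.diagonal q d -> 0 < al -> 0 <= be -> eps = 1 \/ eps = -1 -> eps' = 1 \/ eps' = -1 ->
  (forall l, al * fold_height q d l + be * fold_height q d' l = affine_height q u v w l) ->
  i != j -> j != k -> i != k ->
  (forall l, l \in [:: i; j; k] -> 0 <= eps * line d l /\ 0 <= eps' * line d' l) -> False.
Proof.
move=> dd al0 be0 he he' haff ij jk ik hreg.
have norm_sign (e x : R) : e = 1 \/ e = -1 -> e * x <= `|x| /\ (0 <= e * x -> `|x| = e * x).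
  by case=> ->; rewrite ?mul1r ?mulN1r ?ler_norm ?ler_normr ?lexx ?orbT; split=> //;
    [exact: ger0_norm | rewrite oppr_ge0; exact: ler0_norm].
pose h l := al * (fold_height q d l - eps * line d l)
          + be * (fold_height q d' l - eps' * line d' l).
have h0 l : l \in [:: i; j; k] -> h l = 0.
  move=> /hreg [h1 h2]; rewrite /h /fold_height -/(line d l) -/(line d' l).
  by rewrite (norm_sign _ _ he).2 // (norm_sign _ _ he').2 // !subrr !mulr0 addr0.
have hE l : h l = affine_height q u v w l - al * eps * line d l - be * eps' * line d' l.
  by rewrite -haff /h; ring.
have hl l : h l = 0.
  apply: (mulfI (vertices_not_collinear hq ij jk ik)); rewrite mulr0.
  have -> : orient (q i) (q j) (q k) * h l = orient (q j) (q k) (q l) * h i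
      + orient (q k) (q i) (q l) * h j + orient (q i) (q j) (q l) * h k.
    by rewrite !hE /line /affine_height /orient; ring.
  by rewrite !h0 ?mulr0 ?addr0 // !inE eqxx ?orbT.
have side l : 0 <= eps * line d l.
  have := hl l; rewrite /h => /eqP.
  have [le1 _] := norm_sign eps (line d l) he; have [le2 _] := norm_sign eps' (line d' l) he'.
  have p1 : 0 <= al * (fold_height q d l - eps * line d l).
    by apply: mulr_ge0; rewrite ?subr_ge0 // ltW.
  have p2 : 0 <= be * (fold_height q d' l - eps' * line d' l).
    by apply: mulr_ge0; rewrite ?subr_ge0.
  rewrite (paddr_eq0 p1 p2) mulf_eq0 (gt_eqF al0) /=.
  by move=> /andP[]; rewrite subr_eq0 => /eqP <- _; exact: normr_ge0.
case/andP: dd => d12; rewrite /adjacent -val_eqE ltn_eqF //= => /norP[h1 h2].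
case: he => eE; [case/negP: h1 | case/negP: h2]; apply/forallP => l; have := side l.
  by rewrite eE mul1r.
by rewrite eE mulN1r oppr_ge0.
Qed.

Lemma exists_sign (x : R) : exists2 e : R, e = 1 \/ e = -1 & 0 <= e * x.
Proof.
have [x0|x0] := lerP 0 x; first by exists 1; [left | rewrite mul1r].
by exists (-1); [right | rewrite mulN1r oppr_ge0 ltW].
Qed.

Lemma exists_common_sign (x y : R) : 0 <= x * y ->
  exists2 e : R, e = 1 \/ e = -1 & 0 <= e * x /\ 0 <= e * y.
Proof.
move=> xy; have [x0|x0|->] := ltrgtP x 0.
- exists (-1); first by right.
  by rewrite !mulN1r !oppr_ge0 ltW // -(nmulr_rge0 _ x0).
- by exists 1; [left | rewrite !mul1r ltW // -(pmulr_rge0 _ x0)].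
- by have [e he ey] := exists_sign y; exists e => //; rewrite mulr0.
Qed.

Lemma sign_choice (e x y : R) : e = 1 \/ e = -1 -> x * y < 0 -> 0 <= e * x \/ 0 <= e * y.
Proof.
move=> he xy; have [ex|ex] := lerP 0 (e * x); [by left | right].
have [ey|ey] := lerP 0 (e * y) => //.
have : 0 < (e * x) * (e * y) by rewrite nmulr_rgt0.
by case: he => ->; rewrite ?mul1r ?mulN1r ?mulrNN ltNge ltW.
Qed.

Lemma exists_other_vertex (s : seq 'I_n.+3) : (size s <= 4)%N -> exists l, l \notin s.
Proof.
move=> s4; apply: contrapT => h.
have : (size (enum 'I_n.+3) <= size s)%N.
  apply: uniq_leq_size (enum_uniq _) _ => l _; apply: contrapT => /negP ls.
  by apply: h; exists l.
by rewrite size_enum_ord; lia.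
Qed.

Lemma fold_heights_not_affine d d' (al be u v w : R) :
  Defs.diagonal q d -> Defs.diagonal q d' -> 0 < al -> 0 <= be ->
  (forall l, al * fold_height q d l + be * fold_height q d' l = affine_height q u v w l) ->
  False.
Proof.
move=> dd dd' al0 be0 haff.
have d12 : d.1 != d.2 by rewrite -val_eqE ltn_eqF //; case/andP: dd.
have d12' : d'.1 != d'.2 by rewrite -val_eqE ltn_eqF //; case/andP: dd'.
have [z1 z2] := line_ends d; have [z1' z2'] := line_ends d'.
have region := fold_heights_region dd al0 be0 _ _ haff.
have triple i j k eps eps' : eps = 1 \/ eps = -1 -> eps' = 1 \/ eps' = -1 ->
    i != j -> j != k -> i != k ->
    0 <= eps * line d i -> 0 <= eps * line d j -> 0 <= eps * line d k ->
    0 <= eps' * line d' i -> 0 <= eps' * line d' j -> 0 <= eps' * line d' k -> False.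
  move=> he he' ij jk ik *; apply: (region _ _ i j k he he' ij jk ik) => l.
  by rewrite !inE => /or3P[] /eqP->.
have same : d = d' -> False.
  move=> dE; have [l] := @exists_other_vertex [:: d.1; d.2] isT.
  rewrite !inE negb_or => /andP[l1 l2].
  have [e he el] := exists_sign (line d l); have [e' he' el'] := exists_sign (line d' l).
  apply: (triple d.1 d.2 l e e'); rewrite ?z1 ?z2 ?mulr0 // 1?eq_sym //.
    by rewrite dE z1' mulr0.
  by rewrite dE z2' mulr0.
have in_ends : d'.1 \in [:: d.1; d.2] -> d'.2 \in [:: d.1; d.2] -> False.
  move=> h1 h2; apply: same; have := andP dd; have := andP dd'.
  case: d d' h1 h2 d12' {dd dd' haff d12 z1 z2 z1' z2' region triple} => [i j] [k l] /=.
  rewrite !inE => /orP[]/eqP-> /orP[]/eqP-> => [/eqP//|||/eqP//] //.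
  by move=> _ [h1 _] [h2 _]; move: h1 h2; lia.
(* If the ends of [d] lie on one closed side of [d'], then an end of [d'] outside [d] completes them
   to a forbidden triple: it lies on the line of [d'], and the ends of [d] lie on that of [d]. *)
have [s'|s'] := lerP 0 (line d' d.1 * line d' d.2).
  have [e' he' [e1 e2]] := exists_common_sign s'.
  have third l : line d' l = 0 -> l \notin [:: d.1; d.2] -> False.
    move=> l0; rewrite !inE negb_or => /andP[l1 l2].
    have [e he el] := exists_sign (line d l).
    by apply: (triple d.1 d.2 l e e'); rewrite ?z1 ?z2 ?l0 ?mulr0 // 1?eq_sym.
  apply: in_ends; apply/negPn/negP; exact: third.
have [s|s] := lerP 0 (line d d'.1 * line d d'.2).
  have [e he [e1 e2]] := exists_common_sign s.
  have third l : line d l = 0 -> l \notin [:: d'.1; d'.2] -> False.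
    move=> l0; rewrite !inE negb_or => /andP[l1 l2].
    have [e' he' el'] := exists_sign (line d' l).
    by apply: (triple d'.1 d'.2 l e e'); rewrite ?z1' ?z2' ?l0 ?mulr0 // 1?eq_sym.
  have h1 : d.1 \in [:: d'.1; d'.2] by apply/negPn/negP; exact: third.
  move: s'; rewrite !inE in h1; case/orP: h1 => /eqP ->; rewrite ?z1' ?z2' mul0r ltxx //.
(* Each diagonal now strictly separates the ends of the other. The closed region of a fifth vertex
   contains an end of each diagonal, which gives the triple. *)
have [l] := @exists_other_vertex [:: d.1; d.2; d'.1; d'.2] isT.
rewrite !inE !negb_or => /and4P[l1 l2 l1' l2'].
have [e he el] := exists_sign (line d l); have [e' he' el'] := exists_sign (line d' l).
have [i [i_end ei li]] : exists i, [/\ i \in [:: d.1; d.2], 0 <= e' * line d' i & line d' i != 0].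
  have n0 : line d' d.1 != 0 /\ line d' d.2 != 0.
    by split; apply: contraTneq s' => ->; rewrite ?mul0r ?mulr0 ltxx.
  by case: (sign_choice he' s') => h; [exists d.1 | exists d.2];
    rewrite !inE eqxx ?orbT; split; rewrite ?n0.1 ?n0.2.
have [k [k_end ek]] : exists k, k \in [:: d'.1; d'.2] /\ 0 <= e * line d k.
  by case: (sign_choice he s) => h; [exists d'.1 | exists d'.2]; rewrite !inE eqxx ?orbT.
have di : line d i = 0 by move: i_end; rewrite !inE => /orP[] /eqP->.
have dk' : line d' k = 0 by move: k_end; rewrite !inE => /orP[] /eqP->.
apply: (triple i k l e e'); rewrite ?di ?dk' ?mulr0 //.
- by apply: contraNneq li => ->; rewrite dk'.
- by move: k_end; rewrite !inE => /orP[] /eqP->; rewrite eq_sym.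
- by move: i_end; rewrite !inE => /orP[] /eqP->; rewrite eq_sym.
Qed.

Lemma GKZ_no_opposite_rays : ~ opposite_rays (GKZ q).
Proof.
move=> [c [[[x0 [Px0 _]] nL ray] [mN nLN rayN]]].
have P0 : GKZ q !=set0 by exists x0.
have LP := linealityP _ (max_face_is_face mN).
pose g l := c (delta_mx 0 l) : R.
have cE : c = row_lfun g by exact: row_lfun_coef.
have rowN (f : 'I_n.+3 -> R) : - row_lfun f = row_lfun (fun l => - f l).
  apply/lfunP => x; rewrite opp_lfunE !row_lfunE -sumrN.
  by apply: eq_bigr => l _; rewrite mulNr.
have affL f : lineality (normal_fan (GKZ q)) (row_lfun f) <->
    exists u v w, f = affine_height q u v w.
  split=> [/LP h|[u [v [w ->]]]]; first exact: GKZ_const_affine.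
  by apply/LP => x y Px Py; apply: GKZ_affine_const.
have gN : ~ (exists u v w, g = affine_height q u v w) by move/affL; rewrite -cE.
have gN' : ~ (exists u v w, (fun l => - g l) = affine_height q u v w).
  by move/affL; rewrite -rowN -cE.
have [d dd nd] := GKZ_normal_cone_fold hq P0 gN.
have [d' dd' nd'] := GKZ_normal_cone_fold hq P0 gN'.
rewrite -cE in nd; rewrite -rowN -cE in nd'.
have [t t0 Lt] := ray _ nd; have [s s0 Ls] := rayN _ nd'.
have {Lt} [u [v [w E]]] : exists u v w,
    (fun l => - fold_height q d l - t * g l) = affine_height q u v w.
  apply/affL; move: Lt; set X := (X in lineality _ X); suff -> : X = row_lfun (fun l => - fold_height q d l - t * g l) by [].
  apply/lfunP => x; rewrite /X cE !add_lfunE !opp_lfunE scale_lfunE !row_lfunE.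
  rewrite scaler_sumr -!sumrN -big_split; apply: eq_bigr => l _ /=.
  by rewrite /GRing.scale /=; ring.
have {Ls} [u' [v' [w' E']]] : exists u v w,
    (fun l => - fold_height q d' l - s * - g l) = affine_height q u v w.
  apply/affL; move: Ls; set X := (X in lineality _ X); suff -> : X = row_lfun (fun l => - fold_height q d' l - s * - g l) by [].
  apply/lfunP => x; rewrite /X cE !add_lfunE !opp_lfunE scale_lfunE opp_lfunE !row_lfunE.
  rewrite -!sumrN scaler_sumr -!sumrN -big_split; apply: eq_bigr => l _ /=.
  by rewrite /GRing.scale /=; ring.
have {}E l : - fold_height q d l - t * g l = affine_height q u v w l.
  by have := congr1 (fun f => f l) E.
have {}E' l : - fold_height q d' l - s * - g l = affine_height q u' v' w' l.
  by have := congr1 (fun f => f l) E'.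
(* If [t] is 0, the fold of [d] alone is affine; this is why the second coefficient is only required
   to be nonnegative. *)
have [t00|t00] := eqVneq t 0.
  apply: (@fold_heights_not_affine d d' 1 0 (- u) (- v) (- w) dd dd' ltr01 (lexx 0)) => l.
  by have := E l; rewrite t00 /affine_height; lra.
have tpos : 0 < t by rewrite lt_neqAle eq_sym t00.
(* The combination with weights [s] and [t] eliminates [g]. The diagonals are exchanged because the
   weight of [d'], which is [t], is the one known to be positive. *)
apply: (@fold_heights_not_affine d' d t s (- (s * u + t * u')) (- (s * v + t * v'))
   (- (s * w + t * w')) dd' dd tpos s0) => l.
have -> : t * fold_height q d' l + s * fold_height q d l =
    - (s * (- fold_height q d l - t * g l) + t * (- fold_height q d' l - s * - g l)) by ring.
by rewrite E E' /affine_height; ring.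
Qed.

End NoOppositeRays.

Theorem mainTheorem8 (R : realType) (n : nat) (q : 'I_n.+3 -> 'rV[R]_2)
    (hn : (2 <= n)%N) (hq : convex_polygon q) :
  (forall (sigma : n.-1.-tuple bool) (p : 'I_n.+3 -> 'rV[R]_2),
     signed_polygon sigma p -> ~ normally_isomorphic (GKZ q) (AssI p))
  /\
  (forall (q' : 'I_n.+3 -> 'rV[R]_2) (T : {set 'I_n.+3 * 'I_n.+3})
          (E : vectType R) (P : set E),
     convex_polygon q' -> triangulation q' T -> is_AssII q' T P ->
     ~ normally_isomorphic (GKZ q) P).
Proof.
have [s sE _] := GKZ_seq q; have noray := GKZ_no_opposite_rays hq hn.
split=> [sigma p hp|q' T E P hq' hT hP] iso; apply: noray; rewrite sE in iso *;
  apply: opposite_rays_transfer iso _.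
  exact: AssI_opposite_rays hp.
by apply: AssII_opposite_rays hT hP => //; apply: ltnW.
Qed.
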